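(* Let $m \ge 1$, $n\ge 1$, $\alpha \in (0,1)$, and let ${\bm{A}}_1,\dots,{\bm{A}}_m$ be real $n\times n$ matrices such that (1) $\|{\bm{A}}_i\|_\star \le 1$ for all $i\in[m]$, and (2) $\|{\bm{A}}_{i+1}-{\bm{A}}_i\|_\star \le \alpha$ for all $i \le m-1$. Given matrix-vector multiplication query access to the matrices, a failure rate $\delta>0$ and an error bound $\varepsilon>0$, there is a (randomized) algorithm that outputs a sequence of estimates $t_1,\dots,t_m$ such that for each $i\in[m]$, $$|t_i - \operatorname{tr}({\bm{A}}_i)| \le \varepsilon \quad\text{with probability at least } 1-\delta.$$ The algorithm uses a total of $$O\!\left((m\alpha+1)\log^2(1/\alpha)\,\frac{\sqrt{\log(1/(\alpha\delta))}}{\varepsilon} + m\min(1,\alpha/\varepsilon)\log(1/(\alpha\delta))\right)$$ matrix-vector multiplication queries to ${\bm{A}}_1,\dots,{\bm{A}}_m$.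
   Context: $\|{\bm{X}}\|_\star$ denotes the nuclear (Schatten-$1$) norm, the sum of the singular values of ${\bm{X}}$. In the matrix-vector query model, the algorithm accesses a matrix ${\bm{A}}$ only by choosing vectors $x$ (possibly adaptively, based on previous answers) and receiving ${\bm{A}}x$; the query complexity is the total number of such products. In the dynamic setting, the estimate $t_i$ is produced using queries to ${\bm{A}}_1,\dots,{\bm{A}}_i$ only.
   Formalization: In the query bound, the factors log(1/α), log(1/(αδ)) and m·min(1,α/ε) are each read as max(1,·); the literal bound is false, e.g. for m=1 with α→1 and ε~(1−α)², or for m=1, ε=1/5, α=1/K, δ=e^{−K}. *)

(* Defs.v *)
From HB Require Import structures.
From mathcomp Require Import all_boot all_order all_algebra.
From mathcomp Require Import polyrcf.
From mathcomp Require Import all_classical all_reals all_analysis.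

Set Implicit Arguments.
Unset Strict Implicit.
Unset Printing Implicit Defensive.

Import Order.TTheory GRing.Theory Num.Theory.

Local Open Scope ring_scope.

(* The square roots of the eigenvalues of A^T A, with multiplicity: [rootsR]
   lists each root of the characteristic polynomial once, [mup] counts it. *)
Definition singular_values (R : realType) (n : nat) (A : 'M[R]_n) : seq R :=
  let p := char_poly (A^T *m A) in
  flatten [seq nseq (mup x p) (Num.sqrt x) | x <- rootsR p].

Definition nuclear_norm (R : realType) (n : nat) (A : 'M[R]_n) : R :=
  \sum_(s <- singular_values A) s.

(* Deterministic adaptive online algorithms on m matrices of size n x n, as
   well-founded trees branching on the answers to the queries.  The index of
   the type is the number of estimates already output (so indices start at 0):
   a tree in [query_alg R m n i] is about to produce the estimate for matrix i,
   and until it does so it can only query matrices of index at most i.  A tree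
   that starts at index 0 outputs exactly m estimates. *)
Inductive query_alg (R : realType) (m n : nat) : nat -> Type :=
| Halt : query_alg R m n m
| Query (i : nat) (j : 'I_m) (leji : (j <= i)%N) (x : 'cV[R]_n)
    (next : 'cV[R]_n -> query_alg R m n i) : query_alg R m n i
| Output (i : nat) (t : R) (next : query_alg R m n i.+1) : query_alg R m n i.

Fixpoint outputs (R : realType) (m n : nat) (A : 'I_m -> 'M[R]_n) (i : nat)
    (a : query_alg R m n i) : seq R :=
  match a with
  | Halt => [::]
  | Query _ j _ x next => outputs A (next (A j *m x))
  | Output _ t next => t :: outputs A next
  end.

Fixpoint num_queries (R : realType) (m n : nat) (A : 'I_m -> 'M[R]_n) (i : nat)
    (a : query_alg R m n i) : nat :=
  match a with
  | Halt => 0%N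
  | Query _ j _ x next => (num_queries A (next (A j *m x))).+1
  | Output _ _ next => num_queries A next
  end.

Definition estimate (R : realType) (m n : nat) (A : 'I_m -> 'M[R]_n)
    (a : query_alg R m n 0) (i : 'I_m) : R :=
  nth 0 (outputs A a) i.

Lemma size_outputs (R : realType) (m n : nat) (A : 'I_m -> 'M[R]_n) (i : nat)
    (a : query_alg R m n i) : (i + size (outputs A a))%N = m.
Proof. by elim: a => [|k j _ x next IH|k t next IH] /=; rewrite ?addn0 ?addnS. Qed.

Definition at_least1 (R : realType) (x : R) : R := Num.max 1 x.

(* The expression inside the O(...), under the convention that the logarithms
   and the number m * min(1, alpha / eps) of matrices that get queried are at
   least 1.  Without it the bound is false: log(1/alpha) tends to 0 as alpha
   tends to 1, and when m * alpha < eps the matrix that has to be queried in any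
   case already costs about log(1/delta) if delta is small enough in terms of
   eps. *)
Definition query_bound (R : realType) (m : nat) (alpha delta eps : R) : R :=
  (m%:R * alpha + 1) * at_least1 (ln (1 / alpha)) ^+ 2
    * (Num.sqrt (at_least1 (ln (1 / (alpha * delta)))) / eps)
  + at_least1 (m%:R * Num.min 1 (alpha / eps))
    * at_least1 (ln (1 / (alpha * delta))).

(* Main.v *)
Require Import Defs.
From HB Require Import structures.
From mathcomp Require Import all_boot all_order all_algebra.
From mathcomp Require Import complex polyrcf ring lra zify.
From mathcomp Require Import all_classical all_reals all_analysis.

(* Static estimation.  Starting from P = 1, deflate A repeatedly: query A on a
   random sign vector g, set v = P A g and replace P by P - v v^T / |v|^2.  With
   M = A^T P A, the squared residual F = |PA|_F^2 = tr M drops by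
   (g^T M^2 g) / (g^T M g), which is at least tr M^2 / (2 tr M) with probability
   at least 1/21 (second-moment method).  If |A|_* <= c, Hoelder gives
   (tr M)^3 <= c^2 tr M^2, so each success increases 1 / F by 1 / (2 c^2), and
   F <= 2 c^2 / s after O(s + log(1/delta)) steps except with probability delta.
   As tr A = tr ((1 - P) A) + tr (P A), the first term being known after querying
   the vectors v, it remains to estimate tr (P A) by averages of g^T P A g, whose
   variance is governed by F, boosted by an approximate median of
   O(log(1/delta)) averages.  Balancing the two parts costs
   O(c sqrt(log(1/delta)) / eps + log(1/delta)) queries.

   Online scheme.  With 2^L ~ 1 / alpha, the estimate at a multiple i of 2^L is
   computed from scratch; otherwise, if 2^v is the exact power of 2 dividing i, it
   is the estimate at i - 2^v plus a static estimate of tr (A_i - A_(i - 2^v)),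
   where the difference has nuclear norm at most 2^v alpha.  Indices that are not
   multiples of 2^l0 ~ eps / alpha reuse an earlier estimate.  An estimate
   collects at most L + 1 errors, and the random seed of a level can be shared
   by all its nodes.  All seeds live in a finite set, so measurability is free. *)

Set Implicit Arguments.
Unset Strict Implicit.
Unset Printing Implicit Defensive.

Import Order.TTheory GRing.Theory Num.Theory.

Local Open Scope ring_scope.

(** * Frobenius norm and the spectral theorem *)

Section Frobenius.
Variable R : rcfType.

Definition frob2 m n (A : 'M[R]_(m, n)) : R := \tr (A^T *m A).

Lemma frob2E m n (A : 'M[R]_(m, n)) : frob2 A = \sum_i \sum_j A i j ^+ 2.
Proof.
rewrite /frob2 /mxtrace exchange_big; apply: eq_bigr => j _.
by rewrite mxE; apply: eq_bigr => i _; rewrite mxE expr2.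
Qed.

Lemma frob2_ge0 m n (A : 'M[R]_(m, n)) : 0 <= frob2 A.
Proof. by rewrite frob2E; do 2!apply: sumr_ge0 => ? _; rewrite sqr_ge0. Qed.

Lemma frob2_eq0 m n (A : 'M[R]_(m, n)) : frob2 A = 0 -> A = 0.
Proof.
move=> /eqP; rewrite frob2E psumr_eq0 => [/allP h|i _]; last first.
  by apply: sumr_ge0 => j _; rewrite sqr_ge0.
apply/matrixP => i j; rewrite mxE.
have := h i (mem_index_enum i); rewrite psumr_eq0 => [/allP|? _]; last exact: sqr_ge0.
by move/(_ j (mem_index_enum j)); rewrite sqrf_eq0 => /eqP.
Qed.

Lemma frob2_gt0 m n (A : 'M[R]_(m, n)) : A != 0 -> 0 < frob2 A.
Proof.
by move=> A0; rewrite lt_def frob2_ge0 andbT; apply: contraNneq A0 => /frob2_eq0 ->.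
Qed.

Lemma frob2_tr m n (A : 'M[R]_(m, n)) : frob2 A^T = frob2 A.
Proof. by rewrite /frob2 trmxK mxtrace_mulC. Qed.

(** The quadratic [t ^+ 2 * a - 2 * t * c + b] is a sum of squares, hence nonnegative for every
    t. *)
Lemma cauchy_schwarz_sum (I : finType) (x y : I -> R) :
  (\sum_i x i * y i) ^+ 2 <= (\sum_i x i ^+ 2) * (\sum_i y i ^+ 2).
Proof.
set a := \sum_i x i ^+ 2; set b := \sum_i y i ^+ 2; set c := \sum_i x i * y i.
have a0 : 0 <= a by apply: sumr_ge0 => i _; rewrite sqr_ge0.
have h t : 0 <= t ^+ 2 * a - 2 * t * c + b.
  have -> : t ^+ 2 * a - 2 * t * c + b = \sum_i (t * x i - y i) ^+ 2.
    rewrite /a /b /c !mulr_sumr -sumrB -big_split /=.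
    by apply: eq_bigr => i _; ring.
  by apply: sumr_ge0 => i _; rewrite sqr_ge0.
have [a_eq0|a_neq0] := eqVneq a 0.
  have [c0|c0] := eqVneq c 0; first by rewrite c0 a_eq0 mul0r expr0n.
  have b0 : 0 <= b by apply: sumr_ge0 => i _; rewrite sqr_ge0.
  (* With a = 0 the quadratic is affine in t, and at this t it equals -b - 2 < 0. *)
  have := h ((b + 1) / c); rewrite a_eq0 mulr0 add0r -mulrA divfK //; lra.
have ap : 0 < a by rewrite lt_def a_neq0.
have := h (c / a).
have -> : (c / a) ^+ 2 * a - 2 * (c / a) * c + b = (a * b - c ^+ 2) / a by field.
by rewrite pmulr_lge0 ?invr_gt0 // subr_ge0.
Qed.

Lemma mxtrace_mul_le m n (A : 'M[R]_(m, n)) (B : 'M[R]_(n, m)) :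
  \tr (A *m B) ^+ 2 <= frob2 A * frob2 B.
Proof.
rewrite -(frob2_tr B) !frob2E !pair_big /=.
have -> : \tr (A *m B) = \sum_p A p.1 p.2 * (B^T) p.1 p.2.
  rewrite -(pair_big xpredT xpredT (fun i j => A i j * B^T i j)) /=.
  by apply: eq_bigr => i _; rewrite mxE; apply: eq_bigr => j _; rewrite mxE.
exact: cauchy_schwarz_sum.
Qed.

Lemma frob2_mul_le m n p (A : 'M[R]_(m, n)) (B : 'M[R]_(n, p)) :
  frob2 (A *m B) <= frob2 A * frob2 B.
Proof.
rewrite -(frob2_tr B) (frob2E (A *m B)) (frob2E A) (frob2E B^T) big_distrl /=.
apply: ler_sum => i _; rewrite big_distrr /=; apply: ler_sum => j _.
rewrite mxE; apply: le_trans (cauchy_schwarz_sum _ _) _.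
by apply: ler_wpM2l; [apply: sumr_ge0 => ? _; rewrite sqr_ge0|apply: ler_sum => k _; rewrite mxE].
Qed.

Lemma mxtrace_le m (A : 'M[R]_m) n (U : 'M[R]_(m, n)) V c :
  A = U *m V -> frob2 U <= c -> frob2 V <= c -> `|\tr A| <= c.
Proof.
move=> -> hU hV; have c0 := le_trans (frob2_ge0 U) hU.
rewrite -ler_sqr ?nnegrE // real_normK ?num_real //.
apply: le_trans (mxtrace_mul_le _ _) _.
by rewrite expr2 ler_pM ?frob2_ge0.
Qed.

Definition orthoproj n (P : 'M[R]_n) := P^T = P /\ P *m P = P.

Lemma frob2_proj n (P : 'M[R]_n) m (U : 'M[R]_(n, m)) :
  orthoproj P -> frob2 (P *m U) = \tr (U^T *m P *m U).
Proof. by case=> PT PP; rewrite /frob2 trmx_mul PT -!mulmxA (mulmxA P) PP. Qed.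

(** Pythagoras: 1 - P is an orthogonal projector too, and its share of the squared norm is
    nonnegative. *)
Lemma frob2_proj_le n (P : 'M[R]_n) m (U : 'M[R]_(n, m)) :
  orthoproj P -> frob2 (P *m U) <= frob2 U.
Proof.
move=> hP; have hQ : orthoproj (1%:M - P).
  case: hP => PT PP; split; first by rewrite linearB /= trmx1 PT.
  by rewrite mulmxBr mulmx1 mulmxBl mul1mx PP subrr subr0.
have := frob2_ge0 ((1%:M - P) *m U).
rewrite !frob2_proj // mulmxBr mulmxBl mulmx1 linearB /= subr_ge0; exact.
Qed.

End Frobenius.

(** * The spectral theorem over a real closed field *)

Section Spectral.
Variable R : rcfType.

(** An eigenvector x + iy exists over [R[i]]. Symmetry equates x M y^T with y M x^T, which forces
    Im(l) (|x|^2 + |y|^2) = 0; so l is real, and whichever of x and y is nonzero is a real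
    eigenvector. *)
Lemma symmetric_eigenvector n (M : 'M[R]_n.+1) : M^T = M ->
  exists (a : R) (v : 'rV[R]_n.+1), v != 0 /\ v *m M = a *: v.
Proof.
move=> MT; pose C := R[i]; pose Mc : 'M[C]_n.+1 := map_mx (real_complex R) M.
have [l /eigenvalueP[v vM v0]] := @eigenvalue_closed C _ Mc isT.
pose x : 'rV[R]_n.+1 := map_mx (@complex.Re R) v.
pose y : 'rV[R]_n.+1 := map_mx (@complex.Im R) v.
have E (j : 'I_n.+1) : Complex ((x *m M) 0 j) ((y *m M) 0 j) = (l * v 0 j)%R :> C.
  move/rowP/(_ j): vM; rewrite !mxE => <-; apply/eqP; rewrite eq_complex /=.
  rewrite !raddf_sum /=.
  by apply/andP; split; apply/eqP; apply: eq_bigr => i _; rewrite !mxE;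
    case: (v 0 i) => p q /=; rewrite ?mulr0 ?subr0 ?add0r.
have hx : x *m M = complex.Re l *: x - complex.Im l *: y.
  by apply/rowP => j; have /(congr1 (@complex.Re R)) := E j; rewrite !mxE => /= ->;
    case: l {vM E} => p q; case: (v 0 j) => r s.
have hy : y *m M = complex.Re l *: y + complex.Im l *: x.
  by apply/rowP => j; have /(congr1 (@complex.Im R)) := E j; rewrite !mxE => /= ->;
    case: l {vM E hx} => p q; case: (v 0 j) => r s.
have xy0 : (x != 0) || (y != 0).
  rewrite -negb_and; apply: contraNN v0 => /andP[/eqP x0 /eqP y0].
  apply/eqP/rowP => j; move/rowP/(_ j): x0; move/rowP/(_ j): y0; rewrite !mxE.
  by case: (v 0 j) => p q /= -> ->.
have sym : \tr (x *m M *m y^T) = \tr (y *m M *m x^T).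
  by rewrite -mxtrace_tr !trmx_mul trmxK MT mulmxA.
have l0 : complex.Im l = 0.
  move: sym; rewrite hx hy !mulmxDl !mulNmx -!scalemxAl !mxtraceD linearN /= !mxtraceZ.
  have -> : \tr (y *m x^T) = \tr (x *m y^T) by rewrite -mxtrace_tr trmx_mul trmxK.
  have fx : \tr (x *m x^T) = frob2 x by rewrite mxtrace_mulC.
  have fy : \tr (y *m y^T) = frob2 y by rewrite mxtrace_mulC.
  rewrite fx fy => e.
  have: complex.Im l * (frob2 x + frob2 y) = 0 by lra.
  move/eqP; rewrite mulf_eq0 => /orP[/eqP//|].
  have := frob2_ge0 x; have := frob2_ge0 y.
  by case/orP: xy0 => /frob2_gt0 ? ? ? /eqP ?; lra.
rewrite l0 !scale0r in hx hy; rewrite subr0 in hx; rewrite addr0 in hy.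
by case/orP: xy0 => ?; exists (complex.Re l); [exists x|exists y].
Qed.

(** The reflection along w = v - e sends the unit vector e to v because w^T e = -|w|^2 / 2. If w =
    0, the convention 0^-1 = 0 turns H into the identity, as it should. *)
Lemma householder n (v : 'cV[R]_n.+1) : frob2 v = 1 ->
  exists H : 'M[R]_n.+1, [/\ H^T = H, H *m H = 1%:M & H *m delta_mx 0 0 = v].
Proof.
move=> v1; pose e : 'cV[R]_n.+1 := delta_mx 0 0; pose w := v - e.
pose H : 'M[R]_n.+1 := 1%:M - (2 / frob2 w) *: (w *m w^T).
have ww : w^T *m w = (frob2 w)%:M by rewrite [LHS]mx11_scalar /frob2 /mxtrace big_ord1.
have HT : H^T = H by rewrite /H linearB /= linearZ /= trmx_mul trmxK trmx1.
exists H; split => //.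
  rewrite {1}/H mulmxBl mul1mx -scalemxAl.
  have [w0|w0] := eqVneq (frob2 w) 0.
    by rewrite /H w0 invr0 mulr0 !scale0r !subr0.
  rewrite /H mulmxBr mulmx1 -!scalemxAr mulmxA -(mulmxA w) ww.
  rewrite mul_mx_scalar -scalemxAl; set W := w *m w^T.
  by apply/matrixP => i j; rewrite !mxE; field.
have ee : frob2 e = 1.
  by rewrite /frob2 trmx_delta mul_delta_mx /mxtrace big_ord1 mxE !eqxx.
have [w0|w0] := eqVneq (frob2 w) 0.
  rewrite /H w0 invr0 mulr0 scale0r subr0 mul1mx.
  by apply/eqP; rewrite eq_sym -subr_eq0; apply/eqP/frob2_eq0.
have we : w^T *m e = (- (frob2 w / 2))%:M.
  rewrite [LHS]mx11_scalar; congr (_%:M).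
  have -> : frob2 w = frob2 v + frob2 e - 2 * (v^T *m e) 0 0.
    rewrite /frob2 /w [(v - e)^T]linearB /= mulmxBr !mulmxBl !linearB /=.
    have -> : \tr (e^T *m v) = \tr (v^T *m e) by rewrite -mxtrace_tr trmx_mul trmxK.
    have -> : \tr (v^T *m e) = (v^T *m e) 0 0 by rewrite /mxtrace big_ord1.
    by ring.
  have ee0 : (e^T *m e) 0 0 = 1 by rewrite -ee /frob2 /mxtrace big_ord1.
  rewrite v1 ee.
  by rewrite /w linearB /= mulmxBl mxE [X in _ + X]mxE ee0; lra.
rewrite -/e /H mulmxBl mul1mx -scalemxAl -mulmxA we mul_mx_scalar scalerA.
have -> : 2 / frob2 w * - (frob2 w / 2) = -1 by field.
by rewrite scaleN1r opprK /w addrC subrK.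
Qed.

(** Conjugation by a reflection sending e to a unit eigenvector makes the first column a multiple of
    e; symmetry clears the first row, and induction diagonalizes the remaining block. *)
Lemma symmetric_spectral n (M : 'M[R]_n) : M^T = M ->
  exists (Q : 'M[R]_n) (d : 'rV[R]_n), Q^T *m Q = 1%:M /\ M = Q *m diag_mx d *m Q^T.
Proof.
elim: n M => [|n IH] M MT.
  by exists 1%:M, 0; split; apply/matrixP => -[].
have [a [v [v0 vM]]] := symmetric_eigenvector MT.
pose u : 'cV[R]_n.+1 := (Num.sqrt (frob2 v))^-1 *: v^T.
have fv := frob2_gt0 v0.
have u1 : frob2 u = 1.
  rewrite /frob2 /u [(_ *: _)^T]linearZ /= -scalemxAl -scalemxAr !mxtraceZ mulrA.
  rewrite -/(frob2 v^T) frob2_tr -invfM -expr2 sqr_sqrtr ?ltW //.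
  by rewrite mulVf // gt_eqF.
have Mu : M *m u = a *: u.
  by rewrite /u -scalemxAr -{1}MT -trmx_mul vM linearZ /= !scalerA mulrC.
have [H [HT HH He]] := householder u1.
have [N Ndef] : exists N : 'M[R]_(1 + n), N = H *m M *m H by exists (H *m M *m H).
have NT : N^T = N by rewrite Ndef !trmx_mul HT MT mulmxA.
have Ne : N *m delta_mx 0 0 = a *: (delta_mx 0 0 : 'cV_(1 + n)).
  by rewrite Ndef -!mulmxA He Mu -scalemxAr -He (mulmxA H H) HH mul1mx.
have l0 : lshift n (0 : 'I_1) = (0 : 'I_n.+1) by apply: val_inj.
have N0 i : N i (lshift n 0) = a * (i == lshift n 0)%:R.
  by rewrite l0; have /matrixP/(_ i 0) := Ne; rewrite -colE !mxE eqxx andbT.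
pose N' := drsubmx N.
have N'T : N'^T = N' by rewrite /N' trmx_drsub NT.
have NE : N = block_mx a%:M 0 0 N'.
  rewrite -[LHS]submxK; congr block_mx.
  - by apply/matrixP => i j; rewrite !ord1 !mxE N0 !eqxx mulr1 mulr1n.
  - by apply/matrixP => i j; rewrite !ord1 !mxE -NT mxE N0 eq_rlshift mulr0.
  - by apply/matrixP => i j; rewrite !ord1 !mxE N0 eq_rlshift mulr0.
have [Q' [d' [Q'Q N'E]]] := IH _ N'T.
pose Q1 : 'M[R]_(1 + n) := block_mx 1%:M 0 0 Q'.
pose d1 : 'rV[R]_(1 + n) := row_mx a%:M d'.
have Q1T : Q1^T = block_mx 1%:M 0 0 Q'^T by rewrite /Q1 tr_block_mx trmx1 !trmx0.
have Q1Q : Q1^T *m Q1 = 1%:M.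
  rewrite Q1T /Q1 mulmx_block !mulmx1 !mulmx0 !mul0mx ?addr0 ?add0r Q'Q.
  by rewrite -scalar_mx_block.
exists (H *m Q1), d1; split.
  by rewrite trmx_mul HT -mulmxA (mulmxA H) HH mul1mx; exact: Q1Q.
have NO : N = Q1 *m diag_mx d1 *m Q1^T.
  rewrite Q1T /Q1 /d1 diag_mx_row !mulmx_block !mulmx0 !mul0mx ?addr0 ?add0r.
  rewrite ?mul0mx ?mulmx0 ?mul1mx ?mulmx1 ?addr0 ?add0r -N'E NE; congr block_mx.
  by apply/matrixP => i j; rewrite !ord1 !mxE eqxx !mulr1n.
have ME : M = H *m N *m H by rewrite Ndef !mulmxA HH mul1mx -mulmxA HH mulmx1.
by rewrite ME trmx_mul HT {1}NO !mulmxA.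
Qed.

End Spectral.

(** * The nuclear norm *)

Section NuclearNorm.
Variable R : realType.

Lemma mup_prod_XsubC (s : seq R) x :
  mup x (\prod_(y <- s) ('X - y%:P)) = count_mem x s.
Proof.
elim: s => [|y s IH].
  by rewrite big_nil mupNroot // rootE hornerC oner_eq0.
rewrite big_cons mupM ?polyXsubC_eq0 //; last first.
  by apply/monic_neq0/monic_prod_XsubC.
by rewrite -['X - y%:P]expr1 mup_XsubCX IH /= (eq_sym y); case: (x == y).
Qed.

Lemma char_poly_orthogonal n (Q D : 'M[R]_n) : Q^T *m Q = 1%:M ->
  char_poly (Q *m D *m Q^T) = char_poly D.
Proof.
move=> QQ; have QQ' := mulmx1C QQ.
rewrite /char_poly /char_poly_mx.
have -> : 'X%:M - map_mx polyC (Q *m D *m Q^T) =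
   map_mx polyC Q *m ('X%:M - map_mx polyC D) *m map_mx polyC Q^T.
  rewrite mulmxBr mulmxBl -!map_mxM; congr (_ - _).
  by rewrite mul_mx_scalar -scalemxAl -map_mxM QQ' map_mx1 scalemx1.
by rewrite !det_mulmx mulrAC -det_mulmx -map_mxM QQ' map_mx1 det1 mul1r.
Qed.

(** The characteristic polynomial is the product of the X - d_i, so its distinct roots are [undup s]
    and the multiplicity of a root is its count in s. *)
Lemma nuclear_norm_spectral n (A Q : 'M[R]_n) (d : 'rV[R]_n) :
  Q^T *m Q = 1%:M -> A^T *m A = Q *m diag_mx d *m Q^T ->
  nuclear_norm A = \sum_i Num.sqrt (d 0 i).
Proof.
move=> QQ AA; rewrite /nuclear_norm /singular_values AA.
rewrite char_poly_orthogonal // char_poly_trig ?diag_mx_is_trig //.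
set s := [seq d 0 i | i <- enum 'I_n].
have -> : \prod_(i < n) ('X - (diag_mx d i i)%:P) = \prod_(y <- s) ('X - y%:P).
  by rewrite /s big_map big_enum; apply: eq_bigr => i _; rewrite mxE eqxx mulr1n.
set p := \prod_(y <- s) _.
have p0 : p != 0 by apply/monic_neq0/monic_prod_XsubC.
rewrite big_flatten big_map.
under eq_bigr => x _ do rewrite big_nseq mup_prod_XsubC.
have -> : \sum_i Num.sqrt (d 0 i) = \sum_(y <- s) Num.sqrt y.
  by rewrite /s big_map big_enum.
rewrite -(big_undup_iterop_count _ s xpredT Num.sqrt) /=.
rewrite [LHS](perm_big (undup s)) /=.
  by apply: eq_bigr => x _; rewrite Monoid.iteropE.
apply: uniq_perm; rewrite ?undup_uniq //; first exact: uniq_roots.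
move=> x; rewrite mem_undup.
by rewrite -(roots_on_rootsR p0) in_itv /= root_prod_XsubC.
Qed.

(* Equivalent to having nuclear norm at most c, and visibly subadditive. *)
Definition factorized n (A : 'M[R]_n) (c : R) := exists r (U : 'M[R]_(n, r)) (V : 'M[R]_(r, n)),
  [/\ A = U *m V, frob2 U <= c & frob2 V <= c].

Lemma frob2_col_mx m1 m2 n (A : 'M[R]_(m1, n)) (B : 'M[R]_(m2, n)) :
  frob2 (col_mx A B) = frob2 A + frob2 B.
Proof. by rewrite /frob2 tr_col_mx mul_row_col mxtraceD. Qed.

Lemma factorized0 n : factorized (0 : 'M[R]_n) 0.
Proof.
by exists 0%N, 0, 0; split; rewrite ?mulmx0 // /frob2 mulmx0 mxtrace0.
Qed.

(** The triangle inequality of the nuclear norm: the factors are concatenated, and squared Frobenius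
    norms add up. *)
Lemma factorizedD n (A B : 'M[R]_n) a b :
  factorized A a -> factorized B b -> factorized (A + B) (a + b).
Proof.
move=> [r [U [V [-> hU hV]]]] [s [U' [V' [-> hU' hV']]]].
exists (r + s)%N, (row_mx U U'), (col_mx V V'); split.
- by rewrite mul_row_col.
- by rewrite -frob2_tr tr_row_mx frob2_col_mx !frob2_tr lerD.
- by rewrite frob2_col_mx lerD.
Qed.

Lemma mxtrace_factorized n (A : 'M[R]_n) c : factorized A c -> `|\tr A| <= c.
Proof. by move=> [r [U [V [e hU hV]]]]; apply: mxtrace_le e hU hV. Qed.

Lemma mul_mx_diagE m n (A : 'M[R]_(m, n)) (d : 'rV[R]_n) i j :
  (A *m diag_mx d) i j = A i j * d 0 j.
Proof. by rewrite mul_mx_diag mxE. Qed.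

Lemma gram_spectral n (B Q : 'M[R]_n) (d : 'rV[R]_n) :
  Q^T *m Q = 1%:M -> B^T *m B = Q *m diag_mx d *m Q^T ->
  (B *m Q)^T *m (B *m Q) = diag_mx d.
Proof.
move=> QQ BB; rewrite trmx_mul -mulmxA (mulmxA B^T) BB -!mulmxA QQ mulmx1.
by rewrite mulmxA QQ mul1mx.
Qed.

Lemma gram_eigen_ge0 n (W : 'M[R]_n) (d : 'rV[R]_n) :
  W^T *m W = diag_mx d -> forall i, 0 <= d 0 i.
Proof.
move=> WW i; have /matrixP/(_ i i) := WW; rewrite !mxE eqxx mulr1n => <-.
by apply: sumr_ge0 => j _; rewrite mxE -expr2 sqr_ge0.
Qed.

Lemma frob2_mul_diag n (W : 'M[R]_n) (d e : 'rV[R]_n) :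
  W^T *m W = diag_mx d -> frob2 (W *m diag_mx e) = \sum_i d 0 i * e 0 i ^+ 2.
Proof.
move=> WW; rewrite /frob2 trmx_mul tr_diag_mx -mulmxA (mulmxA W^T) WW.
apply: eq_bigr => i _; rewrite mul_diag_mx mul_mx_diag !mxE eqxx mulr1n; ring.
Qed.

(** The columns of W = A Q are orthogonal with squared lengths d_i = sigma_i^2, and A = W Q^T.
    Moving a factor q_i = sqrt sigma_i from the columns of W to the rows of Q^T leaves two factors
    of squared Frobenius norm sum sigma_i. *)
Lemma nuclear_norm_factorized n (A : 'M[R]_n) c : nuclear_norm A <= c -> factorized A c.
Proof.
have symA : (A^T *m A)^T = A^T *m A by rewrite trmx_mul trmxK.
have [Q [d [QQ AA]]] := symmetric_spectral symA.
rewrite (nuclear_norm_spectral QQ AA) => hc.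
have WW := gram_spectral QQ AA; have d0 := gram_eigen_ge0 WW.
have [W WE] : exists W, W = A *m Q by exists (A *m Q).
rewrite -WE in WW; pose q i : R := Num.sqrt (Num.sqrt (d 0 i)).
have q2 i : q i ^+ 2 = Num.sqrt (d 0 i) by rewrite sqr_sqrtr // sqrtr_ge0.
have q4 i : q i ^+ 4 = d 0 i by rewrite (exprM _ 2 2) q2 sqr_sqrtr.
exists n, (W *m diag_mx (\row_i (q i)^-1)), (diag_mx (\row_i q i) *m Q^T); split.
- have QQ' := mulmx1C QQ.
  have -> : W *m diag_mx (\row_i (q i)^-1) *m (diag_mx (\row_i q i) *m Q^T) = W *m Q^T.
    rewrite mulmxA; congr (_ *m _); apply/matrixP => i j.
    rewrite !mul_mx_diagE !mxE.
    have [qj0|qj0] := eqVneq (q j) 0; last by rewrite mulfVK.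
    (* Column j of W has squared length d_j = 0, so it vanishes and the default 0^-1 = 0 does no
       harm. *)
    rewrite qj0 mulr0; have dj : d 0 j = 0 by rewrite -q4 qj0 expr0n.
    have /matrixP/(_ j j) := WW; rewrite !mxE eqxx mulr1n dj => /eqP.
    rewrite psumr_eq0 => [/allP/(_ i (mem_index_enum i))|k _].
      by rewrite mxE mulf_eq0 orbb => /eqP.
    by rewrite mxE -expr2 sqr_ge0.
  by rewrite WE -mulmxA QQ' mulmx1.
- rewrite (frob2_mul_diag _ WW); apply: le_trans hc; apply: ler_sum => i _.
  rewrite mxE -q2 -q4.
  have [->|qi0] := eqVneq (q i) 0; first by rewrite !expr0n /= mul0r.
  by rewrite (_ : q i ^+ 4 * _ = q i ^+ 2) //; field.
- rewrite -frob2_tr trmx_mul trmxK tr_diag_mx (@frob2_mul_diag _ _ (const_mx 1)).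
    by apply: le_trans hc; apply: ler_sum => i _; rewrite !mxE mul1r q2.
  by rewrite QQ diag_const_mx.
Qed.

(* Trace duality against the partial isometry X of the polar decomposition of B. *)
Lemma sum_singular_le n (B Q : 'M[R]_n) (d : 'rV[R]_n) c :
  Q^T *m Q = 1%:M -> B^T *m B = Q *m diag_mx d *m Q^T -> factorized B c ->
  \sum_i Num.sqrt (d 0 i) <= c.
Proof.
move=> QQ BB [r [U [V [BE hU hV]]]].
have WW := gram_spectral QQ BB; have d0 := gram_eigen_ge0 WW.
have [W WE] : exists W, W = B *m Q by exists (B *m Q).
rewrite -WE in WW.
pose s i : R := Num.sqrt (d 0 i).
have s2 i : s i ^+ 2 = d 0 i by rewrite sqr_sqrtr.
(* Nonzero columns of W are normalized and zero columns stay zero, since 0^-1 = 0; so X^T X is a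
   diagonal of zeros and ones. *)
pose X := W *m diag_mx (\row_i (s i)^-1).
have XX : X^T *m X = diag_mx (\row_i (s i != 0)%:R).
  rewrite /X trmx_mul tr_diag_mx -mulmxA (mulmxA W^T) WW.
  apply/matrixP => i j; rewrite mul_diag_mx mul_mx_diag !mxE.
  have [<-|_] := eqVneq i j; last by rewrite !mulr0n mul0r mulr0.
  rewrite !mulr1n -s2; have [->|si] := eqVneq (s i) 0; first by rewrite expr0n !mul0r mulr0.
  by rewrite /= -[true%:R]/1; field.
have XE : X *m diag_mx (\row_i (s i != 0)%:R) = X.
  apply/matrixP => i j; rewrite /X !mul_mx_diagE !mxE.
  by have [->|_] := eqVneq (s j) 0; rewrite ?invr0 ?mulr0 ?mulr1.
have projX : orthoproj (X *m X^T).
  split; first by rewrite trmx_mul trmxK.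
  by rewrite mulmxA -(mulmxA X) XX XE.
have hXU : frob2 (X^T *m U) <= c.
  apply: le_trans hU; apply: le_trans (frob2_proj_le U projX).
  by rewrite frob2_proj // /frob2 trmx_mul trmxK !mulmxA.
have hVO : frob2 (V *m Q) <= c.
  apply: le_trans hV; rewrite /frob2 trmx_mul -mulmxA mxtrace_mulC -!mulmxA.
  by rewrite (mulmx1C QQ) mulmx1.
(* As B = U V, this trace is tr (X^T B Q), whose diagonal entries are d_i / s_i = s_i. *)
suff -> : \sum_i Num.sqrt (d 0 i) = \tr ((X^T *m U) *m (V *m Q)).
  by apply: le_trans (ler_norm _) _; apply: mxtrace_le hXU hVO.
rewrite mulmxA -(mulmxA X^T) -BE -mulmxA -WE /X trmx_mul tr_diag_mx -mulmxA WW.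
apply: eq_bigr => i _; rewrite mul_diag_mx !mxE eqxx mulr1n -/(s i) -s2.
by have [->|si] := eqVneq (s i) 0; [rewrite expr0n mulr0|field].
Qed.

(** Two Cauchy-Schwarz steps, b^2 <= a c and c^2 <= b e with c the sum of cubes, give b^4 <= a^2 b
    e; then b is cancelled. *)
Lemma holder_sum_124 (I : finType) (s : I -> R) : (forall i, 0 <= s i) ->
  (\sum_i s i ^+ 2) ^+ 3 <= (\sum_i s i) ^+ 2 * \sum_i s i ^+ 4.
Proof.
move=> s0.
set a := \sum_i s i; set b := \sum_i s i ^+ 2; set e := \sum_i s i ^+ 4.
pose c := \sum_i s i ^+ 3.
have a0 : 0 <= a by apply: sumr_ge0.
have b0 : 0 <= b by apply: sumr_ge0 => i _; rewrite exprn_ge0.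
have c0 : 0 <= c by apply: sumr_ge0 => i _; rewrite exprn_ge0.
have e0 : 0 <= e by apply: sumr_ge0 => i _; rewrite exprn_ge0.
have h1 : b ^+ 2 <= a * c.
  have := cauchy_schwarz_sum (fun i => Num.sqrt (s i)) (fun i => Num.sqrt (s i) * s i).
  rewrite (_ : \sum_i _ = b); last first.
    by apply: eq_bigr => i _; rewrite mulrA -expr2 sqr_sqrtr.
  congr (_ <= _ * _); apply: eq_bigr => i _; first by rewrite sqr_sqrtr.
  by rewrite exprMn sqr_sqrtr // -exprS.
have h2 : c ^+ 2 <= b * e.
  have := cauchy_schwarz_sum s (fun i => s i ^+ 2).
  rewrite (_ : \sum_i _ = c); last by apply: eq_bigr => i _; rewrite -exprS.
  by congr (_ <= _ * _); apply: eq_bigr => i _; rewrite -exprM.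
have [b_eq0|b_neq0] := eqVneq b 0.
  by rewrite b_eq0 expr0n mulr_ge0 ?exprn_ge0.
have bp : 0 < b by rewrite lt_def b_neq0.
rewrite -(ler_pM2l bp) -exprS (exprM b 2 2).
apply: (@le_trans _ _ ((a * c) ^+ 2)).
  by rewrite ler_pXn2r ?nnegrE ?mulr_ge0 ?sqr_ge0.
by rewrite exprMn [b * _]mulrCA ler_wpM2l ?sqr_ge0.
Qed.

(** In terms of the singular values of B, the traces are the sums of squares and of fourth powers,
    while the plain sum is at most c. *)
Lemma mxtrace_gram_holder n (B : 'M[R]_n) c : factorized B c ->
  \tr (B^T *m B) ^+ 3 <= c ^+ 2 * \tr ((B^T *m B) *m (B^T *m B)).
Proof.
move=> hB; have BT : (B^T *m B)^T = B^T *m B by rewrite trmx_mul trmxK.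
have [Q [d [QQ BB]]] := symmetric_spectral BT.
have d0 := gram_eigen_ge0 (gram_spectral QQ BB).
have hs := sum_singular_le QQ BB hB.
have s0 i : 0 <= Num.sqrt (d 0 i) by rewrite sqrtr_ge0.
have trO (M : 'M[R]_n) : \tr (Q *m M *m Q^T) = \tr M.
  by rewrite mxtrace_mulC mulmxA QQ mul1mx.
rewrite BB; have -> : Q *m diag_mx d *m Q^T *m (Q *m diag_mx d *m Q^T) =
   Q *m (diag_mx d *m diag_mx d) *m Q^T.
  by rewrite !mulmxA -(mulmxA _ Q^T) QQ mulmx1.
rewrite !trO.
have -> : \tr (diag_mx d) = \sum_i Num.sqrt (d 0 i) ^+ 2.
  by apply: eq_bigr => i _; rewrite mxE eqxx mulr1n sqr_sqrtr.
have -> : \tr (diag_mx d *m diag_mx d) = \sum_i Num.sqrt (d 0 i) ^+ 4.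
  apply: eq_bigr => i _; rewrite mul_diag_mx !mxE eqxx mulr1n.
  by rewrite (exprM _ 2 2) sqr_sqrtr.
apply: le_trans (holder_sum_124 s0) _; apply: ler_wpM2r.
  by apply: sumr_ge0 => i _; rewrite exprn_ge0.
by rewrite ler_pXn2r ?nnegrE ?sumr_ge0 // (le_trans _ hs) ?sumr_ge0.
Qed.

End NuclearNorm.

(** * Uniform expectation and random signs *)

Section UniformExpectation.
Variable R : realFieldType.

(** On an empty type the value is 0, by the convention 0^-1 = 0; hence the inhabitation hypotheses
    below. *)
Definition Ex (T : finType) (f : T -> R) : R := (\sum_x f x) / #|T|%:R.

Definition Pr (T : finType) (b : pred T) : R := Ex (fun x => (b x)%:R).

Lemma eq_Ex (T : finType) (f g : T -> R) : f =1 g -> Ex f = Ex g.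
Proof. by move=> fg; rewrite /Ex (eq_bigr g). Qed.

Lemma ExD (T : finType) (f g : T -> R) : Ex (fun x => f x + g x) = Ex f + Ex g.
Proof. by rewrite /Ex big_split /= mulrDl. Qed.

Lemma ExZ (T : finType) a (f : T -> R) : Ex (fun x => a * f x) = a * Ex f.
Proof. by rewrite /Ex -mulr_sumr mulrA. Qed.

Lemma Ex_sum (T I : finType) (f : I -> T -> R) :
  Ex (fun x => \sum_i f i x) = \sum_i Ex (f i).
Proof. by rewrite /Ex exchange_big mulr_suml. Qed.

Lemma Ex_cst (T : finType) a : (0 < #|T|)%N -> Ex (fun _ : T => a) = a.
Proof.
by move=> T0; rewrite /Ex sumr_const -[a *+ _]mulr_natr mulfK // pnatr_eq0 -lt0n.
Qed.

Lemma le_Ex (T : finType) (f g : T -> R) : (forall x, f x <= g x) -> Ex f <= Ex g.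
Proof. by move=> fg; rewrite ler_wpM2r ?invr_ge0 ?ler0n // ler_sum. Qed.

Lemma Ex_ge0 (T : finType) (f : T -> R) : (forall x, 0 <= f x) -> 0 <= Ex f.
Proof. by move=> f0; rewrite mulr_ge0 ?invr_ge0 ?ler0n // sumr_ge0. Qed.

Lemma Ex_le_cst (T : finType) (f : T -> R) a : 0 <= a -> (forall x, f x <= a) -> Ex f <= a.
Proof.
move=> a0 fa; have [T0|T0] := posnP #|T|; last by rewrite -(Ex_cst a T0) le_Ex.
by rewrite /Ex T0 invr0 mulr0.
Qed.

Lemma Ex_pair (T S : finType) (f : T -> S -> R) :
  Ex (fun p => f p.1 p.2) = Ex (fun x => Ex (f x)).
Proof.
rewrite /Ex card_prod natrM invfM mulrA mulrAC -mulr_suml.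
by rewrite (pair_big xpredT xpredT) /= mulrAC.
Qed.

Lemma Ex_tuple0 (T : finType) (f : seq T -> R) : Ex (fun t : 0.-tuple T => f t) = f [::].
Proof.
rewrite (@eq_Ex _ _ (fun=> f [::])) => [|t]; last by rewrite tuple0.
by rewrite Ex_cst // card_tuple expn0.
Qed.

(** f lives on sequences, not on tuples of a fixed length, so that it can be followed through
    inductions on the length. *)
Lemma Ex_tupleS (T : finType) k (f : seq T -> R) :
  Ex (fun t : k.+1.-tuple T => f t) = Ex (fun x => Ex (fun t : k.-tuple T => f (x :: t))).
Proof.
rewrite -Ex_pair /Ex card_prod !card_tuple expnS; congr (_ / _).
pose h (p : T * k.-tuple T) : k.+1.-tuple T := [tuple of p.1 :: p.2].
pose h' (t : k.+1.-tuple T) : T * k.-tuple T := (thead t, [tuple of behead t]).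
rewrite (reindex h) //=; exists h' => [[x t]|t] _.
  by congr (_, _); apply: val_inj.
by rewrite /h /h' /= [t in RHS]tuple_eta; apply: val_inj.
Qed.

Lemma le_Pr (T : finType) (a b : pred T) : (forall x, a x -> b x) -> Pr a <= Pr b.
Proof.
by move=> ab; apply: le_Ex => x; rewrite ler_nat; case: (a x) (ab x) => // ->.
Qed.

Lemma Pr_or (T : finType) (a b c : pred T) :
  (forall x, a x -> b x || c x) -> Pr a <= Pr b + Pr c.
Proof.
move=> abc; rewrite -ExD; apply: le_Ex => x; rewrite -natrD ler_nat.
by case: (a x) (abc x) => // /(_ isT); case: (b x); case: (c x).
Qed.

Lemma Pr_predC (T : finType) (b : pred T) : (0 < #|T|)%N -> Pr (fun x => ~~ b x) = 1 - Pr b.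
Proof.
move=> T0; rewrite -(Ex_cst 1 T0); apply/eqP; rewrite -subr_eq opprK -ExD; apply/eqP.
by apply: eq_Ex => x; case: (b x); rewrite ?addr0 ?add0r.
Qed.

Lemma markov_Ex (T : finType) (b : pred T) (f : T -> R) a :
  (forall x, 0 <= f x) -> (forall x, b x -> a <= f x) -> a * Pr b <= Ex f.
Proof.
move=> f0 baf; rewrite -ExZ; apply: le_Ex => x.
by case: (boolP (b x)) => [/baf|]; rewrite ?mulr1 ?mulr0.
Qed.

(* Paley-Zygmund for the event f > 0, from f <= (f^2 / (K a) + K a [f > 0]) / 2. *)
Lemma Pr_gt0_second_moment (T : finType) (f : T -> R) a K : 0 < a -> 0 < K ->
  Ex f = a -> Ex (fun x => f x ^+ 2) <= K * a ^+ 2 -> K^-1 <= Pr (fun x => 0 < f x).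
Proof.
move=> a0 K0 fa f2.
pose q := Ex (fun x => (2 * K * a)^-1 * f x ^+ 2 + K * a / 2 * (0 < f x)%R%:R).
have h : a <= q.
  rewrite -[leLHS]fa; apply: le_Ex => x.
  have Ka : 0 < K * a by rewrite mulr_gt0.
  case: ltP => fx; last first.
    by rewrite mulr0 addr0 (le_trans fx) // mulr_ge0 ?sqr_ge0 // invr_ge0 -mulrA mulr_ge0 // ltW.
  rewrite mulr1 -mulrA -(ler_pM2l Ka) -subr_ge0.
  set y := K * a in Ka *.
  have -> : y * ((2 * y)^-1 * f x ^+ 2 + y / 2) - y * f x = (f x - y) ^+ 2 / 2.
    by field; rewrite gt_eqF.
  by rewrite mulr_ge0 ?sqr_ge0.
rewrite /q ExD !ExZ -/(Pr _) in h; set p := Pr _ in h *.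
have h2 : a <= a / 2 + K * a / 2 * p.
  apply: (le_trans h); rewrite lerD2r.
  have -> : a / 2 = (2 * K * a)^-1 * (K * a ^+ 2) by field; rewrite !gt_eqF.
  by apply: ler_wpM2l => //; rewrite invr_ge0 !mulr_ge0 // ltW.
have h3 : a * 1 <= a * (K * p) by lra.
rewrite ler_pM2l // in h3.
by rewrite -[K^-1]mulr1 -(ler_pM2l K0) mulrA divff ?mul1r // gt_eqF.
Qed.

(** The terms are independent and centered, so the cross terms vanish. *)
Lemma Ex_sum_sqr (T : finType) k (f : T -> R) : (0 < #|T|)%N -> Ex f = 0 ->
  Ex (fun t : k.-tuple T => (\sum_(x <- t) f x) ^+ 2) = k%:R * Ex (fun x => f x ^+ 2).
Proof.
move=> T0 f0.
have tup0 k' : (0 < #|{: k'.-tuple T}|)%N by rewrite card_tuple expn_gt0 T0.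
have mean k' : Ex (fun t : k'.-tuple T => \sum_(x <- t) f x) = 0.
  elim: k' => [|k' IH]; first by rewrite (Ex_tuple0 (fun t => \sum_(x <- t) f x)) big_nil.
  rewrite (Ex_tupleS _ (fun t => \sum_(x <- t) f x)) -[RHS]f0.
  by apply: eq_Ex => x; under eq_Ex => t do rewrite big_cons; rewrite ExD Ex_cst // IH addr0.
elim: k => [|k IH].
  by rewrite (Ex_tuple0 (fun t => (\sum_(x <- t) f x) ^+ 2)) big_nil expr0n mul0r.
rewrite (Ex_tupleS _ (fun t => (\sum_(x <- t) f x) ^+ 2)).
under eq_Ex => x.
  under eq_Ex => t do rewrite big_cons sqrrD -mulr_natl -addrA (mulrA 2%:R).
  rewrite ExD Ex_cst // ExD ExZ mean mulr0 add0r IH; over.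
by rewrite ExD Ex_cst // -natr1 mulrDl mul1r addrC.
Qed.

(** Chernoff bound with base 16: each factor has mean 1 + 15 Pr b <= 2, and on the event 16 ^ count
    is at least 4 ^ k, so Markov gives 2 ^ k / 4 ^ k. *)
Lemma Pr_count_ge (T : finType) k (b : pred T) : (0 < #|T|)%N -> Pr b <= 1 / 16 ->
  Pr (fun t : k.-tuple T => k <= (count b t).*2)%N <= (1 / 2) ^+ k.
Proof.
move=> T0 hb.
have h : Ex (fun t : k.-tuple T => 16 ^+ count b t) <= 2 ^+ k.
  elim: k => [|k IH]; first by rewrite (Ex_tuple0 (fun t => 16 ^+ count b t)).
  rewrite (Ex_tupleS _ (fun t => 16 ^+ count b t)).
  under eq_Ex => x do under eq_Ex => t do rewrite /= exprD.
  under eq_Ex => x do rewrite ExZ mulrC.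
  rewrite ExZ exprSr; apply: ler_pM => //.
  - by apply: Ex_ge0 => t; rewrite exprn_ge0.
  - by apply: Ex_ge0 => t; rewrite exprn_ge0.
  have -> : Ex (fun x => 16 ^+ b x) = 1 + 15 * Pr b.
    transitivity (Ex (fun _ : T => 1) + Ex (fun x => 15 * (b x)%:R)); last first.
      by rewrite Ex_cst // ExZ.
    rewrite -ExD; apply: eq_Ex => x.
    by case: (b x); rewrite ?expr1 ?expr0 ?mulr1 ?mulr0 ?addr0 //; ring.
  by lra.
have h2 : 4 ^+ k * Pr (fun t : k.-tuple T => k <= (count b t).*2)%N <=
    Ex (fun t : k.-tuple T => 16 ^+ count b t).
  apply: markov_Ex => [t|t kc]; first by rewrite exprn_ge0.
  rewrite (_ : 16 = 4 ^+ 2 :> R); last by ring.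
  by rewrite -exprM mul2n ler_eXn2l //; lra.
have := le_trans h2 h; rewrite mulrC -ler_pdivlMr ?exprn_gt0 // -exprVn -exprMn.
by congr (_ <= _ ^+ _); field.
Qed.

End UniformExpectation.

(** * Moments of quadratic forms in random signs *)

Section SignVectors.
Variable R : rcfType.
Variable n : nat.

Definition signs : Type := {ffun 'I_n -> bool}.
HB.instance Definition _ := Finite.on signs.

Lemma card_signs_gt0 : (0 < #|{: signs}|)%N.
Proof. by rewrite card_ffun expn_gt0 card_bool. Qed.

Definition signv (g : signs) : 'cV[R]_n := \col_i (-1) ^+ g i.

(** Hutchinson's estimator g^T K g of tr K; the trace of this 1 x 1 matrix makes it a scalar. *)
Definition qform (K : 'M[R]_n) (g : signs) : R := \tr ((signv g)^T *m K *m signv g).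

Lemma qformE K g : qform K g = \sum_i \sum_j K i j * ((-1) ^+ g i * (-1) ^+ g j).
Proof.
rewrite /qform /mxtrace big_ord1 mxE exchange_big; apply: eq_bigr => j _ /=.
rewrite !mxE big_distrl /=; apply: eq_bigr => i _; rewrite !mxE; ring.
Qed.

Definition flip (i : 'I_n) (g : signs) : signs := [ffun j => (j == i) (+) g j].

Lemma flipK i : involutive (flip i).
Proof. by move=> g; apply/ffunP => j; rewrite !ffunE addbA addbb. Qed.

(** Flipping one sign permutes the seeds, so a function odd in that sign averages to 0. *)
Lemma Ex_flip i (f : signs -> R) : (forall g, f (flip i g) = - f g) -> Ex f = 0.
Proof.
move=> fN; suff : Ex f = - Ex f by move=> ?; lra.
rewrite {1}/Ex (reindex_inj (inv_inj (flipK i))) (eq_bigr _ (fun g _ => fN g)).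
by rewrite sumrN mulNr.
Qed.

Lemma sign_flip i j g : (-1) ^+ flip i g j = (if j == i then -1 else 1) * (-1) ^+ g j :> R.
Proof.
by rewrite ffunE; case: (j == i); case: (g j); rewrite ?mul1r ?mulN1r ?opprK //= expr1 expr0.
Qed.

Lemma Ex_sign2 i j : i != j -> Ex (fun g : signs => (-1) ^+ g i * (-1) ^+ g j) = 0 :> R.
Proof.
move=> ij; apply: (Ex_flip (i := i)) => g.
by rewrite !sign_flip eqxx eq_sym (negbTE ij) mul1r mulN1r mulNr.
Qed.

(** If {k, l} = {i, j} the signs cancel in pairs; otherwise some index occurs exactly once, and
    flipping its sign negates the product. *)
Lemma Ex_sign4 i j k l : i != j -> k != l ->
  Ex (fun g : signs => ((-1) ^+ g i * (-1) ^+ g j) * ((-1) ^+ g k * (-1) ^+ g l))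
  = ((k == i) && (l == j) || (k == j) && (l == i))%:R :> R.
Proof.
move=> ij kl.
have sq (g : signs) a : (-1) ^+ g a * (-1) ^+ g a = 1 :> R.
  by rewrite -expr2 sqrr_sign.
have [ki|ki] := eqVneq k i; first rewrite ki in kl *.
  have [lj|lj] := eqVneq l j; first rewrite lj in kl *.
    rewrite /= -[RHS](Ex_cst (1 : R) card_signs_gt0); apply: eq_Ex => g.
    by rewrite mulrACA !sq mulr1.
  rewrite (negbTE ij) /=; apply: (Ex_flip (i := j)) => g.
  rewrite !sign_flip eqxx (negbTE ij) (negbTE lj); ring.
have [kj|kj] := eqVneq k j; first rewrite kj in kl ki *.
  have [li|li] := eqVneq l i; first rewrite li in kl *.
    rewrite /= -[RHS](Ex_cst (1 : R) card_signs_gt0); apply: eq_Ex => g.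
    by rewrite [X in _ * X]mulrC mulrACA !sq mulr1.
  apply: (Ex_flip (i := i)) => g.
  rewrite !sign_flip eqxx (negbTE ki) (negbTE li); ring.
apply: (Ex_flip (i := k)) => g.
rewrite !sign_flip eqxx ![_ == k]eq_sym (negbTE ki) (negbTE kj) (negbTE kl); ring.
Qed.

Lemma Ex_qform K : Ex (qform K) = \tr K.
Proof.
under eq_Ex => g do rewrite qformE.
rewrite Ex_sum; apply: eq_bigr => i _; rewrite Ex_sum (bigD1 i) //= big1 => [|j ji].
  rewrite addr0 ExZ -[RHS]mulr1; congr (_ * _).
  rewrite -[RHS](Ex_cst (1 : R) card_signs_gt0); apply: eq_Ex => g.
  by rewrite -expr2 sqrr_sign.
by rewrite ExZ Ex_sign2 1?eq_sym // mulr0.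
Qed.

Lemma qform_offdiag K g : qform K g - \tr K =
  \sum_(p : 'I_n * 'I_n | p.1 != p.2) K p.1 p.2 * ((-1) ^+ g p.1 * (-1) ^+ g p.2).
Proof.
rewrite qformE pair_big /= (bigID (fun p : 'I_n * 'I_n => p.1 == p.2)) /=.
rewrite (_ : \sum_(p | p.1 == p.2) _ = \tr K) ?[\tr K + _]addrC ?addrK //.
rewrite -(pair_big_dep xpredT (fun i j => i == j)
   (fun i j => K i j * ((-1) ^+ g i * (-1) ^+ g j))) /=.
apply: eq_bigr => i _; rewrite (big_pred1 i) => [|j]; last by rewrite eq_sym.
by rewrite -expr2 sqrr_sign mulr1.
Qed.

(** Only off-diagonal entries fluctuate, and (i, j) correlates only with itself and (j, i). The
    variance is thus the sum of K_ij^2 + K_ij K_ji over i != j, and the mixed term is bounded by the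
    mean of the two squares. *)
Lemma variance_qform K : Ex (fun g => (qform K g - \tr K) ^+ 2) <= 2 * frob2 K.
Proof.
under eq_Ex => g do rewrite qform_offdiag expr2 big_distrlr /=.
pose od := fun p : 'I_n * 'I_n => p.1 != p.2.
have -> : Ex (fun g : signs => \sum_(p | od p) \sum_(q | od q)
     K p.1 p.2 * ((-1) ^+ g p.1 * (-1) ^+ g p.2) *
     (K q.1 q.2 * ((-1) ^+ g q.1 * (-1) ^+ g q.2))) =
   \sum_(p | od p) (K p.1 p.2 ^+ 2 + K p.1 p.2 * K p.2 p.1).
  under eq_Ex => g do rewrite big_mkcond /=.
  rewrite Ex_sum [RHS]big_mkcond; apply: eq_bigr => p _.
  case: ifP => odp; last by rewrite Ex_cst ?card_signs_gt0.
  under eq_Ex => g do rewrite big_mkcond /=.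
  rewrite Ex_sum.
  under eq_bigr => q _.
    rewrite (_ : Ex _ = if od q then K p.1 p.2 * K q.1 q.2 *
       ((q == p) || (q == (p.2, p.1)))%:R else 0); last first.
      case: ifP => odq; last by rewrite Ex_cst ?card_signs_gt0.
      rewrite -[in RHS](Ex_sign4 odp odq) ?xpair_eqE.
      by rewrite -ExZ; apply: eq_Ex => g; ring.
    over.
  rewrite -big_mkcond (bigD1 p) //= (bigD1 (p.2, p.1)) /=; last first.
    by case: p odp => a b; rewrite /od /= xpair_eqE eq_sym => ab; rewrite ab negb_and ab.
  rewrite !eqxx orbT /= !mulr1 -expr2 big1 ?addr0 // => q /andP[/andP[_ h1] h2].
  by rewrite (negbTE h1) (negbTE h2) mulr0.
have sw : \sum_(p | od p) K p.2 p.1 ^+ 2 = \sum_(p | od p) K p.1 p.2 ^+ 2.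
  rewrite (reindex_inj (h := fun p : 'I_n * 'I_n => (p.2, p.1))) /=.
    by apply: eq_bigl => p; rewrite /od /= eq_sym.
  by move=> [a b] [c d] [-> ->].
apply: (@le_trans _ _ (\sum_(p | od p) (3 / 2 * K p.1 p.2 ^+ 2 + 1 / 2 * K p.2 p.1 ^+ 2))).
  by apply: ler_sum => p _; have := sqr_ge0 (K p.1 p.2 - K p.2 p.1); nra.
rewrite big_split /= -!mulr_sumr sw -mulrDl (_ : 3 / 2 + 1 / 2 = 2 :> R); last by field.
rewrite ler_pM2l ?ltr0n // frob2E pair_big /= [leRHS](bigID od) /= lerDl.
by apply: sumr_ge0 => p _; rewrite sqr_ge0.
Qed.

Lemma second_moment_qform K : Ex (fun g => qform K g ^+ 2) <= \tr K ^+ 2 + 2 * frob2 K.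
Proof.
apply: le_trans (lerD (lexx _) (variance_qform K)).
rewrite -(Ex_cst (\tr K ^+ 2) card_signs_gt0) -ExD.
have e0 : Ex (fun g => 2 * \tr K * (qform K g - \tr K)) = 0.
  by rewrite ExZ ExD Ex_qform Ex_cst ?card_signs_gt0 // subrr mulr0.
rewrite -[leRHS]addr0 -e0 -ExD; apply: le_Ex => g.
by rewrite le_eqVlt; apply/orP; left; apply/eqP; ring.
Qed.

End SignVectors.

(** * The static estimator *)

Section Computations.
Variables (R : realType) (n : nat).

(** Kept apart from [query_alg] because the oracle is later a difference of two matrices, each of
    its answers being simulated by two real queries. *)
Inductive comp (X : Type) : Type :=
| Ret (x : X)
| Ask (q : 'cV[R]_n) (next : 'cV[R]_n -> comp X).

Fixpoint run X (A : 'M[R]_n) (c : comp X) : X :=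
  match c with Ret x => x | Ask q next => run A (next (A *m q)) end.

Fixpoint cost X (A : 'M[R]_n) (c : comp X) : nat :=
  match c with Ret _ => 0%N | Ask q next => (cost A (next (A *m q))).+1 end.

Fixpoint bind X Y (c : comp X) (f : X -> comp Y) : comp Y :=
  match c with Ret x => f x | Ask q next => Ask q (fun y => bind (next y) f) end.

Lemma run_bind X Y A (c : comp X) (f : X -> comp Y) : run A (bind c f) = run A (f (run A c)).
Proof. by elim: c => /=. Qed.

Lemma cost_bind X Y A (c : comp X) (f : X -> comp Y) :
  cost A (bind c f) = (cost A c + cost A (f (run A c)))%N.
Proof. by elim: c => //= q next IH; rewrite IH addSn. Qed.

End Computations.
Arguments Ret {R n X}.
Arguments Ask {R n X}.

(** * Deflation by random directions *)

Section Deflation.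
Variables (R : realType) (n : nat).
Implicit Types (A P : 'M[R]_n) (g : signs n).

Definition deflate_by P (v : 'cV[R]_n) : 'M[R]_n := P - (frob2 v)^-1 *: (v *m v^T).

Definition deflate1 A P g := deflate_by P (P *m (A *m signv R g)).

(** Two queries per step: A g yields the direction v = P A g, and A v yields v^T A v / |v|^2, which
    is added to the running value s of tr ((1 - P) A). *)
Fixpoint deflate (gs : seq (signs n)) P (s : R) : comp R n ('M[R]_n * R) :=
  if gs is g :: gs' then
    Ask (signv R g) (fun y => Ask (P *m y) (fun w =>
      deflate gs' (deflate_by P (P *m y))
        (s + (frob2 (P *m y))^-1 * \tr ((P *m y)^T *m w))))
  else Ret (P, s).

Lemma cost_deflate A gs P s : cost A (deflate gs P s) = (size gs).*2.
Proof. by elim: gs P s => //= g gs IH P s; rewrite IH. Qed.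

Lemma run_deflate A gs P s : run A (deflate gs P s) =
  (foldl (deflate1 A) P gs, s + \tr (P *m A) - \tr (foldl (deflate1 A) P gs *m A)).
Proof.
elim: gs P s => [|g gs IH] P s /=; first by rewrite addrK.
rewrite IH; congr (_, _); rewrite {2}/deflate_by.
set v := P *m _; rewrite mulmxBl -scalemxAl linearB /= mxtraceZ -/(deflate1 A P g).
have -> : \tr (v *m v^T *m A) = \tr (v^T *m (A *m v)) by rewrite -mulmxA mxtrace_mulC mulmxA.
by rewrite /deflate1 -/v; ring.
Qed.

Lemma orthoproj1 : orthoproj (1%:M : 'M[R]_n).
Proof. by split; rewrite ?trmx1 ?mulmx1. Qed.

Lemma mul_tr_frob2 (v : 'cV[R]_n) : v^T *m v = (frob2 v)%:M.
Proof. by rewrite [LHS]mx11_scalar /frob2 /mxtrace big_ord1. Qed.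

(** As P v = v, the subtracted matrix is the projector on a line inside the range of P, or 0 when v
    = 0. *)
Lemma orthoproj_deflate1 A P g : orthoproj P -> orthoproj (deflate1 A P g).
Proof.
move=> [PT PP]; rewrite /deflate1 /deflate_by; set v := P *m _.
have Pv : P *m v = v by rewrite /v mulmxA PP.
have vP : v^T *m P = v^T by rewrite -{1}PT -trmx_mul Pv.
split; first by rewrite linearB /= linearZ /= trmx_mul trmxK PT.
rewrite mulmxBr !mulmxBl PP -!scalemxAl -!scalemxAr mulmxA Pv -mulmxA vP.
rewrite mulmxA -(mulmxA v v^T) mul_tr_frob2 mul_mx_scalar -scalemxAl.
set f := frob2 v; set W := v *m v^T.
have [f0|f0] := eqVneq f 0; first by rewrite f0 invr0 !scale0r !subr0.
by apply/matrixP => i j; rewrite !mxE; field.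
Qed.

Definition residual A P : 'M[R]_n := (P *m A)^T *m (P *m A).

Lemma residual_sym A P : (residual A P)^T = residual A P.
Proof. by rewrite /residual trmx_mul trmxK. Qed.

Lemma residualE A P : orthoproj P -> residual A P = A^T *m P *m A.
Proof. by case=> PT PP; rewrite /residual trmx_mul PT -!mulmxA (mulmxA P P) PP. Qed.

Lemma frob2_deflated A P g : orthoproj P ->
  frob2 (P *m (A *m signv R g)) = qform (residual A P) g.
Proof.
by move=> hP; rewrite /frob2 /qform /residual !trmx_mul !mulmxA.
Qed.

Lemma frob2_deflated_row A P g : orthoproj P ->
  frob2 ((P *m (A *m signv R g))^T *m A) = qform (residual A P *m residual A P) g.
Proof.
move=> hP; rewrite /qform -{1}residual_sym /frob2 (residualE A hP).
case: hP => PT PP; rewrite -mxtrace_mulC; congr (\tr _).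
by rewrite !trmx_mul !trmxK PT !mulmxA.
Qed.

Lemma frob2_deflate1 A P g : orthoproj P ->
  frob2 (deflate1 A P g *m A) = frob2 (P *m A)
    - qform (residual A P *m residual A P) g / qform (residual A P) g.
Proof.
move=> hP; rewrite -frob2_deflated_row // -frob2_deflated //.
rewrite frob2_proj; last exact: orthoproj_deflate1.
rewrite frob2_proj // /deflate1 /deflate_by; set v := P *m (A *m _).
rewrite mulmxBr mulmxBl linearB /= -scalemxAr -scalemxAl mxtraceZ mulrC.
by congr (_ - _ / _); rewrite /frob2 (trmx_mul v^T A) trmxK !mulmxA.
Qed.

Lemma qform_gram_ge0 m (B : 'M[R]_(m, n)) g : 0 <= qform (B^T *m B) g.
Proof.
have -> : qform (B^T *m B) g = frob2 (B *m signv R g).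
  by rewrite /qform /frob2 trmx_mul !mulmxA.
exact: frob2_ge0.
Qed.

Lemma qform_residual2_ge0 A P g : 0 <= qform (residual A P *m residual A P) g.
Proof. by rewrite -{1}residual_sym qform_gram_ge0. Qed.

Lemma frob2_deflate1_le A P g : orthoproj P ->
  frob2 (deflate1 A P g *m A) <= frob2 (P *m A).
Proof.
move=> hP; rewrite frob2_deflate1 // lerBlDr lerDl.
by rewrite mulr_ge0 ?qform_residual2_ge0 ?invr_ge0 ?qform_gram_ge0.
Qed.

Lemma frob2_subZ_le m p (X Y : 'M[R]_(m, p)) l :
  frob2 (X - l *: Y) <= 2 * frob2 X + 2 * l ^+ 2 * frob2 Y.
Proof.
rewrite !frob2E !mulr_sumr -big_split; apply: ler_sum => i _ /=.
rewrite !mulr_sumr -big_split; apply: ler_sum => j _ /=; rewrite !mxE.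
have := sqr_ge0 (X i j + l * Y i j); nra.
Qed.

Lemma factorized_proj A P c : orthoproj P -> factorized A c -> factorized (P *m A) c.
Proof.
move=> hP [r [U [V [-> hU hV]]]]; exists r, (P *m U), V; split => //.
  by rewrite mulmxA.
by apply: le_trans hU; apply: frob2_proj_le.
Qed.

(* In terms of u = F / (2 c^2), with F the squared residual, a step with u' <= u - u^2
   raises 1 / u by at least 1. *)
Lemma deflate1_progress A P c k : 0 < c -> factorized A c -> orthoproj P ->
  k%:R * frob2 (P *m A) <= 2 * c ^+ 2 ->
  21^-1 <= Pr R (fun g => k.+1%:R * frob2 (deflate1 A P g *m A) <= 2 * c ^+ 2).
Proof.
move=> c0 hA hP hk; set F := frob2 (P *m A) in hk.
have F0 : 0 <= F by apply: frob2_ge0.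
have c20 : 0 < c ^+ 2 by rewrite exprn_gt0.
have [F_eq0|F_neq0] := eqVneq F 0.
  rewrite (_ : Pr R _ = 1); first by lra.
  rewrite -[RHS](Ex_cst (1 : R) (card_signs_gt0 n)); apply: eq_Ex => g.
  have := frob2_deflate1_le A g hP; rewrite -/F F_eq0 => h.
  have := frob2_ge0 (deflate1 A P g *m A) => h'.
  have -> : frob2 (deflate1 A P g *m A) = 0 by lra.
  by rewrite mulr0 (_ : (0 <= 2 * c ^+ 2)%R = true) //; lra.
have Fp : 0 < F by rewrite lt_def F_neq0.
set M := residual A P; set T := \tr (M *m M).
have holder : F ^+ 3 <= c ^+ 2 * T by apply: mxtrace_gram_holder; apply: factorized_proj.
have Tp : 0 < T.
  have : 0 < c ^+ 2 * T by apply: lt_le_trans holder; rewrite exprn_gt0.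
  by rewrite pmulr_rgt0.
have fM : frob2 M = T by rewrite /frob2 residual_sym.
have TF : T <= F ^+ 2.
  by rewrite -fM expr2; apply: le_trans (frob2_mul_le _ _) _; rewrite frob2_tr.
have fMM : frob2 (M *m M) <= T ^+ 2 by rewrite -fM expr2 frob2_mul_le.
(* K compares g^T M^2 g with l g^T M g. Its trace is T / 2 and its squared norm at most 2 T^2 + T^2
   / 2, so the second moment of its form is at most T^2 / 4 + 5 T^2 = 21 (T / 2)^2; this is the
   source of 21. *)
set l := T / (2 * F); set K := M *m M - l *: M.
have lF : l * F = T / 2 by rewrite /l; field; rewrite gt_eqF.
have trK : \tr K = T / 2.
  by rewrite /K linearB /= mxtraceZ -/T -[\tr M]/F lF; field.
have l2 : l ^+ 2 * T <= T ^+ 2 / 4.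
  have -> : T ^+ 2 / 4 = l ^+ 2 * F ^+ 2 by rewrite -exprMn lF; field.
  by rewrite ler_wpM2l ?sqr_ge0.
have fK : frob2 K <= 5 / 2 * T ^+ 2.
  apply: le_trans (frob2_subZ_le _ _ _) _; rewrite fM; lra.
have hP2 : 21^-1 <= Pr R (fun g => 0 < qform K g).
  apply: (@Pr_gt0_second_moment _ _ _ (T / 2)) => //; first by lra.
    by rewrite Ex_qform.
  by apply: le_trans (second_moment_qform K) _; rewrite trK; lra.
apply: (le_trans hP2); apply: le_Pr => g.
have -> : qform K g = qform (M *m M) g - l * qform M g.
  by rewrite /qform /K mulmxBr mulmxBl linearB /= -scalemxAr -scalemxAl mxtraceZ.
rewrite frob2_deflate1 // -/M -/F => hK.
have Y0 : 0 <= qform M g by apply: qform_gram_ge0.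
(* If g^T M g = |v|^2 vanished, so would v^T A, whose squared norm is g^T M^2 g, contradicting
   [hK]. *)
have Yp : 0 < qform M g.
  rewrite lt_def Y0 andbT; apply/eqP => Y_eq0.
  move: hK; rewrite Y_eq0 mulr0 subr0 -frob2_deflated_row //.
  move: Y_eq0; rewrite -frob2_deflated // => /frob2_eq0 ->.
  by rewrite trmx0 mul0mx /frob2 mulmx0 mxtrace0 ltxx.
have ratio : l <= qform (M *m M) g / qform M g by rewrite ler_pdivlMr //; lra.
have lge : F ^+ 2 / (2 * c ^+ 2) <= l.
  rewrite /l ler_pdivlMr ?mulr_gt0 // mulrAC ler_pdivrMr ?mulr_gt0 //.
  have -> : F ^+ 2 * (2 * F) = 2 * F ^+ 3 by ring.
  by lra.
set u := F / (2 * c ^+ 2).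
have c2p : 0 < 2 * c ^+ 2 by lra.
have Fu : F = u * (2 * c ^+ 2) by rewrite /u divfK // gt_eqF.
have u0 : 0 < u by rewrite divr_gt0.
have ku : k%:R * u <= 1 by rewrite /u mulrA ler_pdivrMr // mul1r.
apply: (@le_trans _ _ (k.+1%:R * ((u - u ^+ 2) * (2 * c ^+ 2)))).
  apply: ler_wpM2l; rewrite ?ler0n //.
  have -> : (u - u ^+ 2) * (2 * c ^+ 2) = F - F ^+ 2 / (2 * c ^+ 2).
    by rewrite mulrBl -Fu /u; congr (_ - _); field; rewrite gt_eqF.
  by lra.
rewrite mulrA -[leRHS]mul1r ler_pM2r //.
(* For k >= 1 the goal (k + 1) (u - u^2) <= 1 follows from (1 - k u) (1 - u) >= 0. *)
have [->|k0] := posnP k; first by nra.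
have k1 : 1 <= k%:R :> R by rewrite ler1n.
have u1 : u <= 1 by nra.
rewrite -natr1; nra.
Qed.

(** k counts the progress certified so far. From any P, a step raises k with probability at least
    1/21, which halves the bound 2^(s - k); on average it shrinks by 1 - 1/2 * 1/21 = 41/42. *)
Lemma deflate_tail A c t : 0 < c -> factorized A c -> forall P k s, orthoproj P ->
  k%:R * frob2 (P *m A) <= 2 * c ^+ 2 ->
  2 ^+ k * Pr R (fun gs : t.-tuple (signs n) =>
     2 * c ^+ 2 < s%:R * frob2 (foldl (deflate1 A) P gs *m A)) <= 2 ^+ s * (41 / 42) ^+ t.
Proof.
move=> c0 hA; pose bad s P gs : bool := 2 * c ^+ 2 < s%:R * frob2 (foldl (deflate1 A) P gs *m A).
elim: t => [|t IH] P k s hP hk.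
  rewrite /Pr (@Ex_tuple0 _ _ (fun gs => (bad s P gs)%:R)) /bad /= expr0 mulr1.
  (* With no step left, the residual F is bad only if k < s, since k F <= 2 c^2 < s F. *)
  case: ltP => hs; last by rewrite mulr0 exprn_ge0.
  rewrite mulr1 ler_eXn2l ?ltr1n //; apply: contraTT hs; rewrite -ltnNge -leNgt => sk.
  by apply: le_trans hk; rewrite ler_wpM2r ?frob2_ge0 // ler_nat ltnW.
rewrite /Pr (@Ex_tupleS _ _ _ (fun gs => (bad s P gs)%:R)) /=.
pose ok g : bool := k.+1%:R * frob2 (deflate1 A P g *m A) <= 2 * c ^+ 2.
pose q : R := 2 ^+ s * (41 / 42) ^+ t.
have hg g : 2 ^+ k * Pr R (fun gs : t.-tuple (signs n) => bad s (deflate1 A P g) gs) <=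
     q - q / 2 * (ok g)%:R.
  have hPg := orthoproj_deflate1 A g hP.
  case: (boolP (ok g)) => [hok|_]; rewrite ?mulr1 ?mulr0 ?subr0.
    by have := IH _ _ s hPg hok; rewrite exprS -/q -/(bad _ _); lra.
  apply: IH => //; apply: le_trans hk; apply: ler_wpM2l; rewrite ?ler0n //.
  exact: frob2_deflate1_le.
rewrite -ExZ; apply: le_trans (le_Ex hg) _.
have q0 : 0 <= q by rewrite mulr_ge0 ?exprn_ge0 //; lra.
have := deflate1_progress c0 hA hP hk; rewrite -/(Pr R ok) => hok.
have -> : Ex (fun g => q - q / 2 * (ok g)%:R) = q - q / 2 * Pr R ok.
  rewrite ExD Ex_cst ?card_signs_gt0 //; congr (_ + _); rewrite -mulNr -ExZ.
  by apply: eq_Ex => g; rewrite mulNr.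
rewrite exprSr mulrA -/q; nra.
Qed.

End Deflation.

(** * Approximate medians *)

Section Majority.
Variable R : realType.

Definition near_majority (e : R) (s : seq R) : R :=
  nth 0 s (find (fun y => size s < (count (fun z => (`|z - y| <= 2 * e)%R) s).*2)%N s).

(** Any entry within e of x qualifies, so the search succeeds. The entries near its result y and
    those near x are both majorities, so they share some z, and |y - x| <= 2 e + e. *)
Lemma near_majority_close (e : R) (s : seq R) x :
  (size s < (count (fun z => (`|z - x| <= e)%R) s).*2)%N -> `|near_majority e s - x| <= 3 * e.
Proof.
move=> maj; set a := fun z => `|z - x| <= e in maj.
pose b (y z : R) : bool := `|z - y| <= 2 * e.
have dist z y : a z -> a y -> b y z.
  by rewrite /a /b => hz hy; rewrite (_ : z - y = (z - x) - (y - x)); [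
    apply: le_trans (ler_normB _ _) _; lra|ring].
have hasp : has (fun y => size s < (count (b y) s).*2)%N s.
  have /hasP[y ys ay] : has a s by rewrite has_count; lia.
  apply/hasP; exists y => //; apply: leq_trans maj _; rewrite leq_double.
  by apply: sub_count => z az; apply: dist.
set y := near_majority e s.
have maj' : (size s < (count (b y) s).*2)%N := nth_find 0 hasp.
have /hasP[z _ /andP[az bz]] : has (predI a (b y)) s.
  rewrite has_count; have := count_predUI a (b y) s; have := count_size (predU a (b y)) s.
  move: maj maj'; set x1 := count _ s; set x2 := count _ s; set x3 := count _ s.
  by set x4 := count _ s; rewrite -!addnn; move: (size s) x1 x2 x3 x4; lia.
rewrite /a in az; rewrite /b in bz.
have -> : y - x = (z - x) - (z - y) by ring.
apply: le_trans (ler_normB _ _) _; lra.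
Qed.

End Majority.

(** * Deflation followed by averaged quadratic forms *)

Section StaticEstimator.
Variables (R : realType) (n : nat).
Implicit Types (A P : 'M[R]_n).

Fixpoint quad_sum P (gs : seq (signs n)) : comp R n R :=
  if gs is g :: gs' then
    Ask (signv R g) (fun y => bind (quad_sum P gs')
      (fun s => Ret (\tr ((signv R g)^T *m P *m y) + s)))
  else Ret 0.

Lemma run_quad_sum A P gs : run A (quad_sum P gs) = \sum_(g <- gs) qform (P *m A) g.
Proof.
elim: gs => [|g gs IH] /=; first by rewrite big_nil.
by rewrite run_bind IH big_cons /qform !mulmxA.
Qed.

Lemma cost_quad_sum A P gs : cost A (quad_sum P gs) = size gs.
Proof. by elim: gs => //= g gs IH; rewrite cost_bind IH addn0. Qed.

Fixpoint quad_means b P (ggs : seq (b.-tuple (signs n))) : comp R n (seq R) :=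
  if ggs is gs :: ggs' then
    bind (quad_sum P gs) (fun x => bind (quad_means P ggs') (fun l => Ret (x / b%:R :: l)))
  else Ret [::].

Lemma run_quad_means A b P (ggs : seq (b.-tuple (signs n))) :
  run A (quad_means P ggs) =
  [seq (\sum_(g <- tval gs) qform (P *m A) g) / b%:R | gs <- ggs].
Proof. by elim: ggs => //= gs ggs IH; rewrite !run_bind IH run_quad_sum. Qed.

Lemma cost_quad_means A b P (ggs : seq (b.-tuple (signs n))) :
  cost A (quad_means P ggs) = (size ggs * b)%N.
Proof.
elim: ggs => //= gs ggs IH.
by rewrite !cost_bind IH cost_quad_sum size_tuple addn0 mulSn.
Qed.

Lemma chebyshev_quad_mean (N : 'M[R]_n) b (e : R) : (0 < b)%N -> 0 < e ->
  Pr R (fun gs : b.-tuple (signs n) => e < `|(\sum_(g <- gs) qform N g) / b%:R - \tr N|)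
  <= 2 * frob2 N / (b%:R * e ^+ 2).
Proof.
move=> b0 e0; have bp : 0 < b%:R :> R by rewrite ltr0n.
rewrite ler_pdivlMr ?mulr_gt0 ?exprn_gt0 // mulrC -(ler_pM2l bp) mulrA.
have hm : Ex (fun g => qform N g - \tr N) = 0.
  by rewrite ExD Ex_qform Ex_cst ?card_signs_gt0 // subrr.
have := Ex_sum_sqr b (card_signs_gt0 n) hm => hE.
apply: (@le_trans _ _ (b%:R * Ex (fun g => (qform N g - \tr N) ^+ 2))); last first.
  by apply: ler_wpM2l; [apply: ltW|apply: variance_qform].
rewrite -hE; apply: markov_Ex => [t|t ht]; first exact: sqr_ge0.
have -> : \sum_(g <- t) (qform N g - \tr N) =
    b%:R * ((\sum_(g <- t) qform N g) / b%:R - \tr N).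
  rewrite big_split /= sumrN big_const_seq count_predT size_tuple iter_addr_0 -mulr_natl.
  by field; rewrite gt_eqF.
rewrite exprMn mulrA -expr2 ler_wpM2l ?sqr_ge0 //.
by rewrite -[leRHS]real_normK ?num_real // ler_pXn2r ?nnegrE ?normr_ge0 ?(ltW e0) ?(ltW ht).
Qed.

Definition static_alg t g b (e : R) (w : t.-tuple (signs n) * g.-tuple (b.-tuple (signs n))) :
    comp R n R :=
  bind (deflate w.1 1%:M 0) (fun Ps =>
    bind (quad_means Ps.1 w.2) (fun l => Ret (Ps.2 + near_majority e l))).

Lemma cost_static_alg A t g b e w : cost A (@static_alg t g b e w) = (t.*2 + g * b)%N.
Proof.
by rewrite /static_alg !cost_bind cost_deflate cost_quad_means !size_tuple addn0.
Qed.

(** Two failures, each of probability at most 2^-g. Deflation falls short of F <= 2 c^2 / s with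
    probability at most 2^s (41/42)^(42 (s + g)), where (41/42)^42 <= 1/2. Otherwise each average is
    off by more than e with probability at most 1/16, and half of them must be off. *)
Lemma static_alg_fail A (c : R) s g b (e : R) : 0 < c -> factorized A c -> (0 < s)%N -> (0 < b)%N ->
  0 < e -> 64 * c ^+ 2 <= s%:R * b%:R * e ^+ 2 ->
  Pr R (fun w => 3 * e < `|run A (@static_alg (42 * (s + g)) g b e w) - \tr A|)
  <= 2 * (1 / 2) ^+ g.
Proof.
move=> c0 hA s0 b0 e0 hsb; set t := (42 * (s + g))%N.
pose Pt (gs : seq (signs n)) := foldl (deflate1 A) 1%:M gs.
pose bad1 (gs : t.-tuple (signs n)) : bool := 2 * c ^+ 2 < s%:R * frob2 (Pt gs *m A).
have sp : 0 < s%:R :> R by rewrite ltr0n.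
have bp : 0 < b%:R :> R by rewrite ltr0n.
have h1 : Pr R bad1 <= (1 / 2) ^+ g.
  have := @deflate_tail _ _ _ _ t c0 hA 1%:M 0%N s (orthoproj1 _ _).
  rewrite mul0r expr0 mul1r => /(_ _)/le_trans; apply; first by rewrite mulr_ge0 ?sqr_ge0.
  rewrite /t exprM exprD mulrA -[leRHS]mul1r.
  have p0 : 0 <= (41 / 42 : R) ^+ 42 <= 1 / 2.
    apply/andP; split; first by apply: exprn_ge0; lra.
    have h7 : (41 / 42) ^+ 7 <= 17 / 20 :> R by lra.
    rewrite (exprM _ 7 6); apply: (@le_trans _ _ ((17 / 20) ^+ 6)); last by lra.
    by apply: lerXn2r; rewrite ?nnegrE ?exprn_ge0 //; lra.
  case/andP: p0 => p0 p1.
  apply: ler_pM; rewrite ?mulr_ge0 ?exprn_ge0 //.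
    by rewrite -exprMn; apply: exprn_ile1; [rewrite mulr_ge0|lra].
  by apply: lerXn2r; rewrite ?nnegrE //; lra.
pose bad2 gs (ggs : g.-tuple (b.-tuple (signs n))) : bool := ~~ bad1 gs &&
   (3 * e < `|run A (static_alg e (gs, ggs)) - \tr A|).
apply: le_trans (@Pr_or R _ _ (fun w => bad1 w.1) (fun w => bad2 w.1 w.2) _) _.
  by move=> [gs ggs] /= h; rewrite /bad2 h andbT; case: (bad1 gs).
rewrite mulrDl mul1r; apply: lerD.
  rewrite /Pr (Ex_pair (fun gs _ => (bad1 gs)%:R)); apply: le_trans h1; apply: le_Ex => gs.
  by apply: Ex_le_cst; rewrite ?ler0n.
rewrite /Pr (Ex_pair (fun gs ggs => (bad2 gs ggs)%:R)); apply: Ex_le_cst => [|gs].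
  by rewrite exprn_ge0.
have [hb|hb] := boolP (bad1 gs).
  by rewrite /bad2 hb /= Ex_le_cst ?exprn_ge0.
set N := Pt gs *m A.
have hN : 2 * frob2 N / (b%:R * e ^+ 2) <= 1 / 16.
  rewrite ler_pdivrMr ?mulr_gt0 ?exprn_gt0 // -(ler_pM2l sp).
  by move: hb; rewrite /bad1 -leNgt -/N => hb; lra.
pose bad3 (t' : b.-tuple (signs n)) : bool :=
  e < `|(\sum_(x <- t') qform N x) / b%:R - \tr N|.
have T0 : (0 < #|{: b.-tuple (signs n)}|)%N by rewrite card_tuple expn_gt0 card_signs_gt0.
have h3 := Pr_count_ge g T0 (le_trans (chebyshev_quad_mean N b0 e0) hN).
apply: le_trans h3; apply: le_Pr => ggs.
apply: contraTT; rewrite -ltnNge => hc; rewrite /bad2 hb /= -leNgt.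
rewrite /static_alg !run_bind /= run_deflate /= run_quad_means mul1mx -/(Pt gs) -/N add0r.
set l := map _ _.
have -> : \tr A - \tr N + near_majority e l - \tr A = near_majority e l - \tr N by ring.
apply: near_majority_close; rewrite /l size_map size_tuple count_map.
have := count_predC bad3 ggs; rewrite size_tuple -/bad3 in hc *.
rewrite (@eq_count _ (predC bad3) (preim (fun gs0 => (\sum_(x <- tval gs0) qform N x) / b%:R)
   (fun z => `|z - \tr N| <= e))) => [|x /=]; last by rewrite /bad3 -leNgt.
have majority (x y z : nat) : (x.*2 < z -> x + y = z -> z < y.*2)%N by lia.
exact: majority hc.
Qed.

End StaticEstimator.

(** * Parameters of the static estimator *)

Section StaticBound.
Variable R : realType.

(** From 1/2 <= exp (-1/2); the additive 2 in the hypothesis absorbs the leading factor, as 2 / e <=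
    1. *)
Lemma half_exp_le (g : nat) (delta : R) : 0 < delta ->
  2 * ln (1 / delta) + 2 <= g%:R -> 2 * (1 / 2) ^+ g <= delta.
Proof.
move=> d0 hg.
have h : (1 / 2) ^+ g <= expR (- (1 / 2)) ^+ g :> R.
  apply: lerXn2r; rewrite ?nnegrE ?expR_ge0 //.
  by have := expR_ge1Dx (- (1 / 2) : R); lra.
have e1 : 2 * expR (- 1) <= 1 :> R.
  have := expR_ge1Dx (1 : R) => h2.
  have := expRxMexpNx_1 (1 : R) => h3.
  have := expR_gt0 (- 1 : R) => h4; nra.
have h2 : expR (- (1 / 2)) ^+ g <= expR (- 1) * delta :> R.
  rewrite -expRM_natl -[delta in leRHS]lnK ?posrE // -expRD ler_expR.
  by move: hg; rewrite div1r lnV ?posrE //; lra.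
have : 2 * (expR (- 1) * delta) <= delta.
  by rewrite mulrA -[leRHS]mul1r ler_pM2r.
lra.
Qed.

Lemma at_least1_ge1 (x : R) : 1 <= at_least1 x.
Proof. by rewrite /at_least1 le_max lexx. Qed.

Lemma le_at_least1 (x : R) : x <= at_least1 x.
Proof. by rewrite /at_least1 le_max lexx orbT. Qed.

Lemma natr_above (x : R) : 0 <= x -> exists k : nat, (0 < k)%N /\ x <= k%:R <= x + 1.
Proof.
move=> x0; exists (Num.truncn x).+1; split=> //.
have /andP[h1 h2] := truncn_itv x0.
by rewrite (ltW h2) -natr1 lerD2r.
Qed.

(* Opaque to unification, which would otherwise unfold the numeral in unary. *)
Definition static_const : R := 10000.

Lemma static_const_gt0 : 0 < static_const.
Proof. by rewrite /static_const ltr0n. Qed.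

Lemma static_estimator n (c eps delta : R) : 0 < c -> 0 < eps -> 0 < delta ->
  exists (T : finType) (alg : T -> comp R n R), [/\ (0 < #|T|)%N,
    forall A w, (cost A (alg w))%:R <=
      static_const *
        (c / eps * Num.sqrt (at_least1 (ln (1 / delta))) + at_least1 (ln (1 / delta))) &
    forall A, factorized A c -> Pr R (fun w => eps < `|run A (alg w) - \tr A|) <= delta].
Proof.
move=> c0 e0 d0; set l := at_least1 _.
have l1 : 1 <= l := at_least1_ge1 _.
have hl : ln (1 / delta) <= l := le_at_least1 _.
(* 4 l exceeds 2 ln (1 / delta) + 2, since l is at least ln (1 / delta) and at least 1. *)
have [|g [g0 /andP[g1 g2]]] := @natr_above (4 * l); first by lra.
(* The median loses a factor 3, so averages aim at eps / 3 and s b >= x^2 = 64 c^2 / (eps / 3)^2 is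
   required. Taking s ~ x sqrt g and b ~ x / sqrt g balances the deflation cost s with the averaging
   cost g b. *)
set x := 24 * (c / eps).
have x0 : 0 < x by rewrite mulr_gt0 // divr_gt0.
have gp : 0 < g%:R :> R by rewrite ltr0n.
set r := Num.sqrt g%:R : R.
have rp : 0 < r by rewrite sqrtr_gt0.
have r2 : r ^+ 2 = g%:R by rewrite sqr_sqrtr // ltW.
have [|s [s0 /andP[s1 s2]]] := @natr_above (x * r); first by rewrite mulr_ge0 ?ltW.
have [|b [b0 /andP[b1 b2]]] := @natr_above (x / r); first by rewrite divr_ge0 ?ltW.
exists _, (@static_alg R n (42 * (s + g)) g b (eps / 3)); split.
- by rewrite card_prod muln_gt0 !card_tuple !expn_gt0 !card_signs_gt0.
- move=> A w; rewrite cost_static_alg -mul2n natrD !natrM. rewrite natrD.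
  have sl : r <= 3 * Num.sqrt l.
    have q0 : 0 <= Num.sqrt l := sqrtr_ge0 _.
    have q2 : Num.sqrt l ^+ 2 = l by rewrite sqr_sqrtr //; lra.
    by rewrite -ler_sqr ?nnegrE ?mulr_ge0 ?(ltW rp) // exprMn q2 r2; lra.
  have gb : g%:R * b%:R <= x * r + g%:R.
    apply: le_trans (ler_wpM2l (ltW gp) b2) _.
    by rewrite mulrDr mulr1 lerD2r -r2 (_ : r ^+ 2 * (x / r) = x * r) //; field; rewrite gt_eqF.
  have xr : x * r <= 72 * (c / eps * Num.sqrt l).
    apply: le_trans (ler_wpM2l (ltW x0) sl) _; rewrite /x; lra.
  have : 0 <= c / eps * Num.sqrt l by rewrite mulr_ge0 ?sqrtr_ge0 // divr_ge0 ?ltW.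
  rewrite /static_const; lra.
move=> A hA; have e3 : 0 < eps / 3 by lra.
apply: le_trans (half_exp_le d0 (_ : _ <= g%:R)); last by lra.
have := @static_alg_fail R n A c s g b (eps / 3) c0 hA s0 b0 e3.
rewrite (_ : 3 * (eps / 3) = eps); last by field.
apply; have -> : 64 * c ^+ 2 = x * r * (x / r) * (eps / 3) ^+ 2.
  by rewrite /x; field; rewrite !gt_eqF.
rewrite ler_wpM2r ?sqr_ge0 // ler_pM // ?mulr_ge0 ?ltW // ?invr_gt0 //.
Qed.

(** The product of the seed types of the levels below L. Bounds valid for every seed pass to it, and
    so does the law of each single level. *)
Lemma independent_copies (X : Type) (x0 : X) (F : nat -> finType) (a : forall l, F l -> X) L :
  (forall l, (0 < #|F l|)%N) ->
  exists (T : finType) (a' : nat -> T -> X), [/\ (0 < #|T|)%N,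
    forall l w, (l < L)%N -> exists x, a' l w = a l x &
    forall l (b : pred X), (l < L)%N -> Pr R (fun w => b (a' l w)) = Pr R (fun x => b (a l x))].
Proof.
move=> F0; elim: L => [|L [T [a' [T0 ha' hP]]]].
  by exists unit, (fun _ _ => x0); split=> //; rewrite card_unit.
exists (T * F L)%type, (fun l w => if l == L then a L w.2 else a' l w.1); split.
- by rewrite card_prod muln_gt0 T0 F0.
- move=> l w; rewrite ltnS leq_eqVlt; case: eqP => [->|_ /= /ha' h]; last exact: h.
  by exists w.2.
- move=> l b; rewrite ltnS leq_eqVlt; case: eqP => [->|_ /= lL].
    by rewrite /Pr (Ex_pair (fun _ x => (b (a L x))%:R)) Ex_cst.
  rewrite -(hP _ b lL) /Pr (Ex_pair (fun w _ => (b (a' l w))%:R)).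
  by apply: eq_Ex => w; rewrite Ex_cst.
Qed.

End StaticBound.

Arguments static_const {R}.
Global Opaque static_const.

(** * The online scheme *)

Section Online.
Variables (R : realType) (m n : nat).
Implicit Types (A : 'I_m -> 'M[R]_n).

Fixpoint embed X (i : nat)
    (ask : 'cV[R]_n -> ('cV[R]_n -> query_alg R m n i) -> query_alg R m n i)
    (c : comp R n X) (k : X -> query_alg R m n i) : query_alg R m n i :=
  match c with
  | Ret x => k x
  | Ask q next => ask q (fun y => embed ask (next y) k)
  end.

Definition mx_at A (k : nat) : 'M[R]_n := oapp A 0 (insub k).

Lemma mx_atE A (i : 'I_m) : mx_at A i = A i.
Proof. by rewrite /mx_at valK. Qed.

(** [None] marks an estimate made from scratch, that is, a difference with 0. *)
Definition mx_diff A (ref : nat -> option nat) (i : nat) : 'M[R]_n :=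
  mx_at A i - oapp (mx_at A) 0 (ref i).

Section Embed.
Variables (X : Type) (i : nat) (D : ('I_m -> 'M[R]_n) -> 'M[R]_n).
Variable ask : 'cV[R]_n -> ('cV[R]_n -> query_alg R m n i) -> query_alg R m n i.
Hypothesis askO : forall A q k, outputs A (ask q k) = outputs A (k (D A *m q)).
Hypothesis askN : forall A q k,
  (num_queries A (ask q k) <= 2 + num_queries A (k (D A *m q)))%N.

Lemma outputs_embed A (c : comp R n X) k :
  outputs A (embed ask c k) = outputs A (k (run (D A) c)).
Proof. by elim: c => //= q next IH; rewrite askO IH. Qed.

Lemma num_queries_embed A (c : comp R n X) k :
  (num_queries A (embed ask c k) <= (cost (D A) c).*2 + num_queries A (k (run (D A) c)))%N.
Proof.
elim: c => //= q next IH; apply: leq_trans (askN _ _ _) _.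
by rewrite doubleS !addSn !ltnS add0n; exact: IH.
Qed.

End Embed.

(** By linearity two products give the answer, and both indices are at most i, as the online model
    demands. *)
Lemma ask_diff (ref : nat -> option nat) i : (i < m)%N ->
  (forall j, ref i = Some j -> (j < i)%N) ->
  exists ask : 'cV[R]_n -> ('cV[R]_n -> query_alg R m n i) -> query_alg R m n i,
    (forall A q k, outputs A (ask q k) = outputs A (k (mx_diff A ref i *m q))) /\
    (forall A q k, (num_queries A (ask q k) <=
       2 + num_queries A (k (mx_diff A ref i *m q)))%N).
Proof.
move=> im hj; pose oi := Ordinal im.
have Ei A : mx_at A i = A oi by rewrite -(mx_atE A oi).
rewrite /mx_diff; case: (ref i) hj => [j|] hj /=; last first.
  exists (fun q k => @Query R m n i oi (leqnn i) q k).
  by split=> A q k /=; rewrite subr0 Ei // add2n ltnS leqnSn.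
have ji := hj j erefl; pose oj := Ordinal (ltn_trans ji im).
have Ej A : mx_at A j = A oj by rewrite -(mx_atE A oj).
exists (fun q k => @Query R m n i oi (leqnn i) q (fun y =>
   @Query R m n i oj (ltnW ji) q (fun z => k (y - z)))).
by split=> A q k /=; rewrite mulmxBl Ei Ej.
Qed.

(** An estimate adds to an earlier one, so the tree is built for every possible list [hist] of past
    outputs, by induction on the number k of estimates still due. *)
Lemma online_alg_from (ref : nat -> option nat) (c : nat -> comp R n R) :
  (forall i j, ref i = Some j -> (j < i)%N) ->
  forall k i (hist : seq R), (i + k)%N = m -> size hist = i ->
  exists a : query_alg R m n i, forall A,
    (forall i', (i <= i' < m)%N -> nth 0 (hist ++ outputs A a) i' =
        oapp (nth 0 (hist ++ outputs A a)) 0 (ref i') + run (mx_diff A ref i') (c i')) /\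
    (num_queries A a <= \sum_(i <= i' < m) (cost (mx_diff A ref i') (c i')).*2)%N.
Proof.
move=> href; elim=> [|k IH] i hist.
  rewrite addn0 => im _; subst i; exists (Halt R m n) => A; split => [i'|//].
  by case/andP => /leq_ltn_trans h/h; rewrite ltnn.
rewrite addnS => im si; have lim : (i < m)%N by lia.
have hv (v : R) : exists a : query_alg R m n i.+1, forall A,
    (forall i', (i.+1 <= i' < m)%N -> nth 0 (rcons hist v ++ outputs A a) i' =
        oapp (nth 0 (rcons hist v ++ outputs A a)) 0 (ref i') + run (mx_diff A ref i') (c i')) /\
    (num_queries A a <= \sum_(i.+1 <= i' < m) (cost (mx_diff A ref i') (c i')).*2)%N.
  by apply: IH; rewrite ?size_rcons ?si // addSn.
(* The rest of the tree depends on the value v just output. *)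
have [f hf] := choice hv.
have [ask [askO askN]] := ask_diff lim (href i).
pose base := oapp (nth 0 hist) 0 (ref i).
exists (embed ask (c i) (fun x => Output (base + x) (f (base + x)))) => A.
set v := base + run (mx_diff A ref i) (c i).
have [hO hN] := hf v A.
have Oe : outputs A (embed ask (c i) (fun x => Output (base + x) (f (base + x)))) =
    v :: outputs A (f v) by rewrite (outputs_embed askO).
split; last first.
  rewrite big_ltn //; apply: leq_trans (num_queries_embed askN _ _ _) _.
  by rewrite leq_add2l.
rewrite Oe -cat_rcons => i' /andP[ii' i'm].
move: ii'; rewrite leq_eqVlt => /orP[/eqP<-|ii']; last by apply: hO; rewrite ii'.
rewrite nth_cat size_rcons si ltnSn nth_rcons si ltnn eqxx /v /base.
case ri: (ref i) => [j|//] /=; congr (_ + _).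
have ji := href _ _ ri.
by rewrite nth_cat size_rcons si ltnS (ltnW ji) nth_rcons si ji.
Qed.

Lemma online_alg (ref : nat -> option nat) (c : nat -> comp R n R) :
  (forall i j, ref i = Some j -> (j < i)%N) ->
  exists a : query_alg R m n 0, forall A,
    (forall i, (i < m)%N -> nth 0 (outputs A a) i =
        oapp (nth 0 (outputs A a)) 0 (ref i) + run (mx_diff A ref i) (c i)) /\
    (num_queries A a <= \sum_(i < m) (cost (mx_diff A ref i) (c i)).*2)%N.
Proof.
move=> href; have [a ha] := online_alg_from c href (add0n m) (erefl : size [::] = 0%N).
by exists a => A; have [h1 h2] := ha A; rewrite big_mkord in h2; split.
Qed.

Lemma factorized_drift A alpha :
  (forall i j : 'I_m, j = i.+1 :> nat -> nuclear_norm (A j - A i) <= alpha) ->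
  forall d i, (i + d < m)%N -> factorized (mx_at A (i + d) - mx_at A i) (d%:R * alpha).
Proof.
move=> hA; elim=> [|d IH] i im; first by rewrite addn0 subrr mul0r; apply: factorized0.
have im' : (i + d < m)%N by lia.
have im'' : ((i + d).+1 < m)%N by lia.
rewrite addnS -natr1 mulrDl mul1r.
have -> : mx_at A (i + d).+1 - mx_at A i =
    (mx_at A (i + d) - mx_at A i) + (mx_at A (i + d).+1 - mx_at A (i + d)).
  by rewrite [RHS]addrC addrA subrK.
apply: factorizedD; first exact: IH.
apply: nuclear_norm_factorized.
rewrite (mx_atE A (Ordinal im')) (mx_atE A (Ordinal im'')); exact: hA.
Qed.

End Online.

(** * The dyadic scheme and its error *)

Section Scheme.
Variables (R : realType) (m n : nat) (L l0 : nat).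

(** Index 0 falls under the first case, so the junk value [logn 2 0] is never consulted. *)
Definition anchor (i : nat) : option nat :=
  if (2 ^ L %| i)%N then None
  else if (l0 <= logn 2 i)%N then Some (i - 2 ^ logn 2 i)%N
  else Some (i - i %% 2 ^ l0)%N.

Definition node_comp (a : nat -> comp R n R) (i : nat) : comp R n R :=
  if (2 ^ L %| i)%N then a L
  else if (l0 <= logn 2 i)%N then a (logn 2 i) else Ret 0.

Lemma anchor_lt i j : anchor i = Some j -> (j < i)%N.
Proof.
rewrite /anchor; case: ifP => // dL.
have i0 : (0 < i)%N by rewrite lt0n; apply: contraFneq dL => ->; rewrite dvdn0.
case: ifP => [_ [<-]|hl [<-]].
  have : (0 < 2 ^ logn 2 i)%N by rewrite expn_gt0.
  by lia.
have : (i %% 2 ^ l0 != 0)%N.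
  by apply/negP => h; move: hl; rewrite -pfactor_dvdn // /dvdn h.
by have := leq_mod i (2 ^ l0); lia.
Qed.

Variables (T : finType) (a : nat -> T -> comp R n R) (A : 'I_m -> 'M[R]_n).
Variables (alpha e delta : R).
Hypothesis l0L : (l0 <= L)%N.
Hypothesis e0 : 0 < e.
Hypothesis delta0 : 0 < delta.
Hypothesis hA1 : forall i : 'I_m, nuclear_norm (A i) <= 1.
Hypothesis hA : forall i j : 'I_m, j = i.+1 :> nat -> nuclear_norm (A j - A i) <= alpha.
Hypothesis aL : forall D, factorized D 1 ->
  Pr R (fun w => e < `|run D (a L w) - \tr D|) <= delta.
Hypothesis al : forall l D, (l < L)%N -> factorized D ((2 ^ l)%:R * alpha) ->
  Pr R (fun w => e < `|run D (a l w) - \tr D|) <= delta.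
Variable est : nat -> T -> R.
Hypothesis estE : forall i w, (i < m)%N -> est i w =
  oapp (est^~ w) 0 (anchor i) + run (mx_diff A anchor i) (node_comp (a^~ w) i).

(** Induction up the levels, d being the distance to L: the anchor of an index of valuation exactly
    k is divisible by 2^(k + 1), and each level adds one error e and one failure probability
    delta. *)
Lemma node_error d k i : (k + d)%N = L -> (l0 <= k)%N -> (2 ^ k %| i)%N -> (i < m)%N ->
  Pr R (fun w => d.+1%:R * e < `|est i w - \tr (mx_at A i)|) <= d.+1%:R * delta.
Proof.
elim: d k i => [|d IH] k i kd l0k ki im.
  rewrite addn0 in kd; rewrite kd in ki.
  have hD : mx_diff A anchor i = mx_at A i by rewrite /mx_diff /anchor ki subr0.
  rewrite !mul1r; apply: le_trans (aL (D := mx_at A i) _).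
    by apply: le_Pr => w; rewrite estE // hD /anchor /node_comp ki add0r.
  by apply: nuclear_norm_factorized; rewrite (mx_atE A (Ordinal im)).
have [ki'|ki'] := boolP (2 ^ k.+1 %| i)%N.
  apply: (@le_trans _ _ (d.+1%:R * delta)); last by rewrite ler_wpM2r ?ler_nat // ltW.
  apply: le_trans (IH k.+1 i _ _ ki' im); rewrite ?addSnnS //; last exact: leqW.
  by apply: le_Pr => w; apply: le_lt_trans; rewrite ler_wpM2r ?ler_nat // ltW.
have i0 : (0 < i)%N by rewrite lt0n; apply: contraNneq ki' => ->; rewrite dvdn0.
have lk : logn 2 i = k.
  apply/eqP; rewrite eqn_leq -[(_ <= k)%N]negbK -ltnNge -!pfactor_dvdn //.
  by rewrite ki' ki.
have kL : (k < L)%N by lia.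
have nL : (2 ^ L %| i)%N = false by rewrite pfactor_dvdn // lk leqNgt kL.
have i2 : (2 ^ k <= i)%N by rewrite dvdn_leq.
set j := (i - 2 ^ k)%N.
have aj : anchor i = Some j by rewrite /anchor nL lk l0k.
(* i is an odd multiple of 2^k, so subtracting 2^k leaves an even multiple. *)
have jk : (2 ^ k.+1 %| j)%N.
  have /dvdnP[q iq] := ki.
  rewrite /j iq -{2}[(2 ^ k)%N]mul1n -mulnBl expnS dvdn_pmul2r ?expn_gt0 //.
  move: ki'; rewrite iq expnS dvdn_pmul2r ?expn_gt0 // !dvdn2 negbK.
  by case: q {iq} => // q; rewrite subn1 /= => ->.
have jm : (j < m)%N by apply: leq_ltn_trans im; rewrite leq_subr.
have iE : i = (j + 2 ^ k)%N by rewrite subnK.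
set D := mx_at A i - mx_at A j.
have hD : mx_diff A anchor i = D by rewrite /mx_diff aj.
have fD : factorized D ((2 ^ k)%:R * alpha).
  by rewrite /D {1}iE; apply: (factorized_drift hA); rewrite -iE.
have := IH k.+1 j; rewrite addSnnS => /(_ kd (leqW l0k) jk jm) hj.
rewrite -natr1 !mulrDl !mul1r; apply: le_trans (lerD hj (al kL fD)).
apply: Pr_or => w; rewrite estE // aj hD /node_comp nL lk l0k /=.
have -> : est j w + run D (a k w) - \tr (mx_at A i) =
   (est j w - \tr (mx_at A j)) + (run D (a k w) - \tr D) by rewrite /D linearB /=; ring.
apply: contraTT; rewrite negb_or -!leNgt => /andP[h1 h2].
by apply: le_trans (ler_normD _ _) (lerD h1 h2).
Qed.

(** Between multiples of 2^l0 the estimate is copied from the multiple just below, at the price of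
    the drift of the trace since then. *)
Lemma online_error i : (i < m)%N ->
  Pr R (fun w => (L - l0).+1%:R * e + (i %% 2 ^ l0)%:R * alpha < `|est i w - \tr (mx_at A i)|)
  <= (L - l0).+1%:R * delta.
Proof.
move=> im; set r := (i %% 2 ^ l0)%N.
have [r0|r0] := posnP r.
  rewrite r0 mul0r addr0; apply: (node_error (k := l0)) => //; last by rewrite /dvdn -/r r0.
  by rewrite subnKC.
pose b := (i - r)%N; have ri : (r <= i)%N := leq_mod _ _.
have iE : i = (b + r)%N by rewrite subnK.
have bm : (b < m)%N by rewrite (leq_ltn_trans _ im) // leq_subr.
have b0 : (2 ^ l0 %| b)%N by rewrite /b /r {1}(divn_eq i (2 ^ l0)) addnK dvdn_mull.
have ni : ~~ (2 ^ l0 %| i)%N by rewrite /dvdn -/r -lt0n.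
have i0 : (0 < i)%N by rewrite lt0n; apply: contraNneq ni => ->; rewrite dvdn0.
have nL : (2 ^ L %| i)%N = false.
  by apply: contraNF ni; apply: dvdn_trans; rewrite dvdn_exp2l.
have nl : (l0 <= logn 2 i)%N = false by rewrite -pfactor_dvdn // (negbTE ni).
have ab : anchor i = Some b by rewrite /anchor nL nl.
have eb w : est i w = est b w by rewrite estE // ab /node_comp nL nl /= addr0.
have := node_error (subnKC l0L) (leqnn _) b0 bm.
apply: le_trans; apply: le_Pr => w; rewrite eb; apply: contraTT; rewrite -!leNgt => h.
have drift : `|\tr (mx_at A i - mx_at A b)| <= r%:R * alpha.
  by apply: mxtrace_factorized; rewrite {1}iE; apply: (factorized_drift hA); rewrite -iE.
have -> : est b w - \tr (mx_at A i) =
   (est b w - \tr (mx_at A b)) - \tr (mx_at A i - mx_at A b) by rewrite linearB /=; ring.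
by apply: le_trans (ler_normB _ _) (lerD h drift).
Qed.

End Scheme.

Lemma count_multiples q m : (0 < q)%N ->
  (\sum_(i < m.+1) ((q %| i) && (0 < i))%N)%N = (m %/ q)%N.
Proof.
move=> q0; elim: m => [|m IH]; first by rewrite big_ord1 andbF div0n.
by rewrite big_ord_recr /= IH divnS // addnC andbT.
Qed.

(** * Probability space and query count *)

Local Open Scope classical_set_scope.
Local Open Scope ring_scope.

Section UniformNat.
Variables (R : realType) (N : nat).

Fact weight_ge0 : 0 <= N.+1%:R^-1 :> R. Proof. by rewrite invr_ge0 ler0n. Qed.

Definition unif_nat : set nat -> \bar R :=
  mscale (NngNum weight_ge0) (msum (fun k => \d_k : {measure set nat -> \bar R}) N.+1).

HB.instance Definition _ := Measure.on unif_nat.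

Lemma unif_natE (b : pred nat) :
  unif_nat [set k | b k] = ((\sum_(k < N.+1) (b k)%:R) / N.+1%:R)%:E.
Proof.
rewrite /unif_nat /mscale /= /msum /=.
under eq_bigr => k _ do rewrite /= diracE.
rewrite sumEFin -EFinM mulrC; congr (_ / _)%:E; apply: eq_bigr => k _.
by congr (_%:R); congr nat_of_bool; apply/idP/idP; rewrite in_setE.
Qed.

Lemma unif_nat_setT : unif_nat [set: nat] = 1%E.
Proof.
rewrite (_ : setT = [set k | xpredT k]); last by apply/seteqP.
by rewrite unif_natE sumr_const card_ord divff // pnatr_eq0.
Qed.

HB.instance Definition _ := Measure_isProbability.Build _ _ _ unif_nat unif_nat_setT.

End UniformNat.

(** The elements of T are numbered and drawn by a uniform index on [nat], where every set is
    measurable. *)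
Lemma finite_uniform_space (R : realType) (T : finType) : (0 < #|T|)%N ->
  exists (d : measure_display) (Omega : measurableType d) (P : probability Omega R)
    (f : Omega -> T), forall b : pred T,
    measurable [set w | b (f w)] /\ P [set w | b (f w)] = (Pr R b)%:E.
Proof.
move=> T0; have /card_gt0P[x0 _] := T0.
exists _, nat, (unif_nat R #|T|.-1), (fun k => nth x0 (enum T) k) => b; split=> //.
apply: etrans (unif_natE R #|T|.-1 (fun k => b (nth x0 (enum T) k))) _.
rewrite /Pr /Ex prednK //; congr (_ / _)%:E.
rewrite -(big_mkord xpredT (fun k => (b (nth x0 (enum T) k))%:R)) cardE.
by rewrite -(big_nth x0 xpredT (fun x => (b x)%:R)) big_enum.
Qed.

(** * Counting queries level by level *)

Section CostBound.
Variables (R : realType) (m n L l0 : nat).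

Lemma count_multiples_le q : (0 < q)%N ->
  (\sum_(i < m) ((q %| i) && (0 < i))%N)%:R <= m%:R / q%:R :> R.
Proof.
move=> q0; rewrite ler_pdivlMr ?ltr0n // -natrM ler_nat.
case: m => [|m']; first by rewrite big_ord0.
by rewrite count_multiples // (leq_trans (leq_divM _ _)).
Qed.

Lemma count_multiples0_le q : (0 < q)%N ->
  (\sum_(i < m) (q %| i)%N)%:R <= 1 + m%:R / q%:R :> R.
Proof.
move=> q0; apply: le_trans (lerD (lexx 1) (count_multiples_le q0)).
rewrite -[X in X + _]/(1%:R) -natrD ler_nat.
case: m => [|m']; first by rewrite big_ord0.
by rewrite !big_ord_recl dvdn0 /= add0n leq_add2l leq_sum // => i _; rewrite andbT.
Qed.

(** A positive index of valuation l < L is charged to level l, which has at most m / 2^l of them;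
    multiples of 2^L, including 0, go to level L. The factor 2 pays for simulating differences. *)
Lemma scheme_cost (a : nat -> comp R n R) (D : nat -> 'M[R]_n) (q : nat -> R) :
  (forall l, 0 <= q l) -> (forall l B, (l <= L)%N -> (cost B (a l))%:R <= q l) ->
  (\sum_(i < m) (cost (D i) (node_comp L l0 a i)).*2)%:R <=
  2 * ((1 + m%:R / (2 ^ L)%:R) * q L + \sum_(l0 <= l < L) m%:R / (2 ^ l)%:R * q l).
Proof.
move=> q0 hq.
have hnode i : (cost (D i) (node_comp L l0 a i))%:R <= (2 ^ L %| i)%N%:R * q L +
    \sum_(l0 <= l < L) ((2 ^ l %| i) && (0 < i))%N%:R * q l.
  have s0 : 0 <= \sum_(l0 <= l < L) ((2 ^ l %| i) && (0 < i))%N%:R * q l.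
    by apply: sumr_ge0 => l _; rewrite mulr_ge0.
  rewrite /node_comp; case: ifP => dL.
    by rewrite mul1r -[leLHS]addr0 lerD // hq.
  rewrite mul0r add0r; case: ifP => // hl.
  have i0 : (0 < i)%N by rewrite lt0n; apply: contraFneq dL => ->; rewrite dvdn0.
  have lL : (logn 2 i < L)%N by rewrite ltnNge -pfactor_dvdn // dL.
  rewrite (bigD1_seq (logn 2 i)) ?iota_uniq //=; last by rewrite mem_index_iota hl.
  rewrite pfactor_dvdn // leqnn i0 mul1r -[leLHS]addr0 lerD ?hq // ?(ltnW lL) //.
  by apply: sumr_ge0 => l _; rewrite mulr_ge0.
rewrite natr_sum; apply: (@le_trans _ _ (\sum_(i < m) 2 * ((2 ^ L %| i)%N%:R * q L +
    \sum_(l0 <= l < L) ((2 ^ l %| i) && (0 < i))%N%:R * q l))).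
  by apply: ler_sum => i _; rewrite -mul2n natrM ler_pM2l ?ltr0n.
rewrite -mulr_sumr ler_pM2l ?ltr0n // big_split /=; apply: lerD.
  by rewrite -mulr_suml -natr_sum ler_wpM2r ?count_multiples0_le ?expn_gt0.
rewrite exchange_big; apply: ler_sum => l _ /=.
by rewrite -mulr_suml -natr_sum ler_wpM2r ?count_multiples_le ?expn_gt0.
Qed.

Lemma sum_geometric : \sum_(l0 <= l < L) (2 ^ l)%:R^-1 <= 2 / (2 ^ l0)%:R :> R.
Proof.
have pw k : 0 < (2 ^ k)%:R^-1 :> R by rewrite invr_gt0 ltr0n expn_gt0.
have [Ll|lL] := leqP L l0; first by rewrite big_geq // mulr_ge0 // ltW.
suff h d : \sum_(l0 <= l < l0 + d) (2 ^ l)%:R^-1 <= 2 / (2 ^ l0)%:R - 2 / (2 ^ (l0 + d))%:R :> R.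
  have := h (L - l0)%N; rewrite subnKC ?(ltnW lL) // => /le_trans; apply.
  by have := pw L; lra.
elim: d => [|d IH]; first by rewrite addn0 big_geq // subrr.
rewrite addnS big_nat_recr ?leq_addr //=.
have -> : (2 ^ (l0 + d).+1)%:R^-1 = (2 ^ (l0 + d))%:R^-1 / 2 :> R.
  by rewrite expnS natrM invfM mulrC.
by lra.
Qed.

End CostBound.

Lemma pow2_floor (R : realType) (x : R) : 1 <= x ->
  exists k : nat, (2 ^ k)%:R <= x < (2 ^ k.+1)%:R.
Proof.
move=> x1; have x0 : 0 <= x by lra.
have /andP[h1 h2] := truncn_itv x0.
have t0 : (0 < Num.truncn x)%N by rewrite truncn_gt0.
exists (trunc_log 2 (Num.truncn x)); apply/andP; split.
  by apply: le_trans h1; rewrite ler_nat trunc_logP.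
by apply: lt_le_trans h2 _; rewrite ler_nat trunc_log_ltn.
Qed.

(** * Choice of the levels and the total bound *)

Section QueryBound.
Variable R : realType.
Implicit Types alpha delta eps : R.

Lemma query_bound_ge0 m alpha delta eps : 0 < alpha -> 0 < eps ->
  0 <= query_bound m alpha delta eps.
Proof.
move=> a0 e0; have ge0 (x : R) : 0 <= at_least1 x.
  by apply: le_trans (at_least1_ge1 x); rewrite ler01.
have h : 0 <= m%:R * alpha + 1 by rewrite addr_ge0 // mulr_ge0 // ltW.
by rewrite /query_bound addr_ge0 ?mulr_ge0 ?exprn_ge0 ?sqrtr_ge0 ?invr_ge0 ?(ltW e0).
Qed.

(** exp (1/2) <= 2, so exp (L / 2) <= 2^L <= 1 / alpha. *)
Lemma level_le_ln (L : nat) alpha : 0 < alpha -> (2 ^ L)%:R <= 1 / alpha ->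
  L%:R <= 2 * ln (1 / alpha).
Proof.
move=> a0 hL; have h : expR (1 / 2) <= 2 :> R.
  have := expR_ge1Dx (- (1 / 2) : R) => h2.
  have := expRxMexpNx_1 (1 / 2 : R) => h3.
  have := expR_gt0 (1 / 2 : R) => h4; nra.
have : expR (L%:R * (1 / 2)) <= expR (ln (1 / alpha)) :> R.
  rewrite lnK ?posrE ?divr_gt0 //; apply: le_trans hL.
  by rewrite expRM_natl natrX lerXn2r ?nnegrE ?expR_ge0.
rewrite ler_expR; lra.
Qed.

(** 2^l0 is the power of 2 just below eps / (2 alpha), or 1 if that ratio is below 1. The drift
    inside a block then uses at most half of eps, and eps < 1 keeps l0 below L. *)
Lemma subsampling_level alpha eps (L : nat) : 0 < alpha -> 0 < eps < 1 ->
  1 / alpha < (2 ^ L.+1)%:R -> exists l0 : nat,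
  [/\ (l0 <= L)%N, forall i, (i %% 2 ^ l0)%:R * alpha <= eps / 2 &
      (2 ^ l0)%:R^-1 <= 4 * Num.min 1 (alpha / eps)].
Proof.
move=> a0 /andP[e0 e1] hL.
have [x1|x1] := lerP 1 (eps / (2 * alpha)); last first.
  exists 0%N; split=> // [i|].
    by rewrite expn0 modn1 mul0r; lra.
  rewrite expn0 invr1; move: x1; rewrite ltr_pdivrMr ?mulr_gt0 // mul1r => x1.
  have : 1 / 4 <= Num.min 1 (alpha / eps) :> R; last by lra.
  by rewrite le_min; apply/andP; split; [lra|rewrite ler_pdivlMr //; lra].
have [l0 /andP[h1 h2]] := pow2_floor x1; exists l0.
have h1' : (2 ^ l0)%:R * alpha <= eps / 2.
  rewrite -ler_pdivlMr //; apply: le_trans h1 _.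
  by rewrite (_ : eps / 2 / alpha = eps / (2 * alpha)) //; field; rewrite gt_eqF.
have p0 : 0 < (2 ^ l0)%:R :> R by rewrite ltr0n expn_gt0.
split.
- rewrite -ltnS -(@ltn_exp2l 2) // -(@ltr_nat R); apply: le_lt_trans hL.
  rewrite ler_pdivlMr //; lra.
- move=> i; apply: le_trans h1'; rewrite ler_pM2r // ler_nat ltnW // ltn_mod expn_gt0 //.
move: h2; rewrite expnS natrM ltr_pdivrMr ?mulr_gt0 // => h2.
suff : (2 ^ l0)%:R^-1 / 4 <= Num.min 1 (alpha / eps) by lra.
rewrite le_min; apply/andP; split.
  have : (2 ^ l0)%:R^-1 <= 1 :> R by rewrite invf_le1 // ler1n expn_gt0.
  by lra.
rewrite ler_pdivlMr //; suff : (2 ^ l0)%:R^-1 * eps <= 4 * alpha by lra.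
by rewrite ler_pdivrMl //; lra.
Qed.

(** At level l the factors 2^-l and 2^l cancel, so each level has the same main cost m alpha y sqrt
    ell. The number of levels and the accuracy eps / (2 (L + 1)) in y each give one factor L, hence
    the squared logarithm; the additive terms ell sum geometrically from l0. *)
Lemma scheme_cost_bound m (L l0 : nat) alpha delta eps (ell : R) (q : nat -> R) :
  0 < alpha < 1 -> 0 < delta -> 0 < eps < 1 ->
  (2 ^ L)%:R <= 1 / alpha < (2 ^ L.+1)%:R ->
  (2 ^ l0)%:R^-1 <= 4 * Num.min 1 (alpha / eps) ->
  ell = at_least1 (ln (1 / (delta / L.+1%:R))) ->
  (forall l, q l =
    (if (l < L)%N then (2 ^ l)%:R * alpha else 1) / (eps / (2 * L.+1%:R)) * Num.sqrt ell + ell) ->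
  2 * ((1 + m%:R / (2 ^ L)%:R) * q L + \sum_(l0 <= l < L) m%:R / (2 ^ l)%:R * q l) <=
  48 * query_bound m alpha delta eps.
Proof.
move=> /andP[a0 a1] d0 /andP[e0 e1] /andP[L1 L2] hl0 ellE qE.
rewrite /query_bound; set mn := Num.min _ _ in hl0 *.
set Lam := at_least1 (ln (1 / alpha)); set ls := at_least1 (ln (1 / (alpha * delta))).
set B := at_least1 _; set M : R := m%:R; set K : R := L.+1%:R.
have K1 : 1 <= K by rewrite ler1n.
have K0 := le_trans ler01 K1.
have M0 : 0 <= M by rewrite ler0n.
have p2 k : 0 < (2 ^ k)%:R :> R by rewrite ltr0n expn_gt0.
have LamL : L%:R <= 2 * Lam.
  by apply: le_trans (level_le_ln a0 L1) _; rewrite ler_pM2l ?ltr0n // le_at_least1.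
have Lam1 : 1 <= Lam := at_least1_ge1 _.
have KE : K = L%:R + 1 by rewrite /K -natr1.
(* Splitting delta over the levels is free: L + 1 <= 2^L <= 1 / alpha. *)
have ellls : ell <= ls.
  rewrite ellE /ls /at_least1 ge_max le_max lexx /= le_max; apply/orP; right.
  rewrite ler_ln ?posrE ?divr_gt0 ?mulr_gt0 ?divr_gt0 // ?ltr0n //.
  have -> : 1 / (delta / K) = K / delta by field; rewrite !gt_eqF // (lt_le_trans ltr01 K1).
  have -> : 1 / (alpha * delta) = 1 / alpha / delta by field; rewrite !gt_eqF.
  rewrite ler_wpM2r ?invr_ge0 ?(ltW d0) //; apply: le_trans L1.
  by rewrite ler_nat; exact: ltn_expl.
have ell1 : 1 <= ell by rewrite ellE at_least1_ge1.
have ell0 := le_trans ler01 ell1.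
set sg := Num.sqrt ell in qE; set S := Num.sqrt ls.
have sgS : sg <= S by rewrite ler_wsqrtr.
have sg0 : 0 <= sg := sqrtr_ge0 _.
have mnB : M * mn <= B := le_at_least1 _.
have B1 : 1 <= B := at_least1_ge1 _.
have amn : alpha <= mn.
  by rewrite le_min ltW //= ler_pdivlMr // -[leRHS]mulr1 ler_pM2l // ltW.
have aB : M * alpha <= B by apply: le_trans mnB; rewrite ler_wpM2l.
pose y := 2 * K / eps.
have y0 : 0 <= y by rewrite divr_ge0 ?(ltW e0) // mulr_ge0.
have yE x : x / (eps / (2 * K)) = x * y by rewrite /y invf_div.
have qL : q L = y * sg + ell by rewrite qE ltnn yE mul1r.
have uL : M / (2 ^ L)%:R <= 2 * (M * alpha).
  rewrite mulrCA; apply: ler_wpM2l => //.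
  move: L2; rewrite expnS natrM ltr_pdivrMr // => L2.
  by rewrite -[_^-1]mul1r ler_pdivrMr // ltW // [2 * alpha]mulrC -mulrA mulrC.
have Ma0 : 0 <= M * alpha by rewrite mulr_ge0 // ltW.
have sumq : \sum_(l0 <= l < L) M / (2 ^ l)%:R * q l <=
    L%:R * (M * alpha * y * sg) + 8 * B * ell.
  have -> : \sum_(l0 <= l < L) M / (2 ^ l)%:R * q l =
     (L - l0)%:R * (M * alpha * y * sg) + M * ell * \sum_(l0 <= l < L) (2 ^ l)%:R^-1.
    have -> : (L - l0)%:R * (M * alpha * y * sg) = \sum_(l0 <= l < L) M * alpha * y * sg.
      by rewrite sumr_const_nat mulr_natl.
    rewrite [M * ell * _]mulr_sumr -big_split /=.
    apply: eq_big_nat => l /andP[_ lL]; rewrite qE lL yE.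
    by field; rewrite gt_eqF.
  apply: lerD.
    by rewrite ler_wpM2r ?ler_nat ?leq_subr // (mulr_ge0 (mulr_ge0 Ma0 y0)).
  have gs := sum_geometric R L l0.
  apply: le_trans (ler_wpM2l _ gs) _; first by rewrite mulr_ge0.
  have -> : M * ell * (2 / (2 ^ l0)%:R) = 2 * (M * (2 ^ l0)%:R^-1) * ell by ring.
  rewrite ler_wpM2r //.
  suff : M * (2 ^ l0)%:R^-1 <= 4 * (M * mn) by clear -mnB; lra.
  by rewrite mulrCA ler_wpM2l.
(* 24 = 2 * 3 * 4, from L + 1 <= 3 Lam and L + 2 <= 4 Lam. *)
have h1 : y * sg * ((1 + 2 * (M * alpha)) + L%:R * (M * alpha)) <=
    24 * ((M * alpha + 1) * Lam ^+ 2 * (S / eps)).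
  apply: (@le_trans _ _ (y * S * ((L%:R + 2) * (M * alpha + 1)))).
    have LMa0 : 0 <= L%:R * (M * alpha) by rewrite mulr_ge0.
    have L0 : 0 <= L%:R :> R by [].
    by apply: ler_pM; [exact: mulr_ge0|clear -LMa0 Ma0; lra|exact: ler_wpM2l|clear -L0 Ma0; lra].
  have -> : y * S * ((L%:R + 2) * (M * alpha + 1)) =
      2 * (K * (L%:R + 2)) * ((M * alpha + 1) * (S / eps)) by rewrite /y; field; rewrite gt_eqF.
  have -> : 24 * ((M * alpha + 1) * Lam ^+ 2 * (S / eps)) =
      24 * Lam ^+ 2 * ((M * alpha + 1) * (S / eps)) by ring.
  apply: ler_wpM2r; first by rewrite mulr_ge0 ?addr_ge0 // divr_ge0 ?sqrtr_ge0 // ltW.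
  suff : K * (L%:R + 2) <= (3 * Lam) * (4 * Lam) by clear; lra.
  by rewrite KE ler_pM ?addr_ge0 //; clear -LamL Lam1; lra.
have h2 : ell * ((1 + 2 * (M * alpha)) + 8 * B) <= 11 * (B * ls).
  rewrite [11 * _]mulrA [ell * _]mulrC; apply: ler_pM => //.
    by clear -Ma0 B1; lra.
  by clear -aB B1; lra.
have h3 : (1 + M / (2 ^ L)%:R) * q L <= (1 + 2 * (M * alpha)) * (y * sg + ell).
  rewrite qL; apply: ler_wpM2r; last by rewrite lerD2l.
  by rewrite addr_ge0 // mulr_ge0.
have Bls : 0 <= B * ls by rewrite mulr_ge0 ?(le_trans ler01 B1) ?(le_trans ell0 ellls).
by clear -h1 h2 h3 sumq Bls; lra.
Qed.

End QueryBound.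

(** * Assembly of the online algorithm *)

Lemma seeded_online_alg (R : realType) (m n : nat) (alpha delta eps : R) :
  0 < alpha < 1 -> 0 < delta -> 0 < eps ->
  exists (T : finType) (alg : T -> query_alg R m n 0), (0 < #|T|)%N /\
    forall A : 'I_m -> 'M[R]_n,
      (forall i : 'I_m, nuclear_norm (A i) <= 1) ->
      (forall i j : 'I_m, j = i.+1 :> nat -> nuclear_norm (A j - A i) <= alpha) ->
      (forall w, (num_queries A (alg w))%:R <= 48 * static_const * query_bound m alpha delta eps) /\
      (forall i : 'I_m, Pr R (fun w => eps < `|estimate A (alg w) i - \tr (A i)|) <= delta).
Proof.
move=> /andP[a0 a1] d0 e0.
(* If eps >= 1, the answer 0 without queries is correct because |tr A_i| <= 1; if delta >= 1, any
   answer will do. *)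
have [triv|/norP[]] := boolP ((1 <= eps) || (1 <= delta)).
  have [//|a ha] := @online_alg R m n (fun=> None) (fun=> Ret 0).
  exists unit, (fun=> a); split=> [|A hA1 _]; first by rewrite card_unit.
  have [hO hN] := ha A; split=> [_|i].
    rewrite big1 // leqn0 in hN; rewrite (eqP hN).
    apply: mulr_ge0; last exact: query_bound_ge0.
    exact: mulr_ge0 (ltW (static_const_gt0 _)).
  case/orP: triv => [e1|d1]; last first.
    by apply: Ex_le_cst => [|w]; rewrite ?(ltW d0) // (le_trans _ d1) // lern1 leq_b1.
  apply: Ex_le_cst => [|w]; first exact: ltW.
  rewrite /estimate hO //= add0r sub0r normrN ltNge.
  rewrite (le_trans _ e1) ?(ltW d0) //.
  by apply: mxtrace_factorized; apply: nuclear_norm_factorized.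
rewrite -!ltNge => e1 d1.
have [|L /andP[L1 L2]] := @pow2_floor R (1 / alpha).
  by rewrite ler_pdivlMr // mul1r ltW.
have e01 : 0 < eps < 1 by rewrite e0.
have [l0 [l0L hl0 hl0']] := subsampling_level a0 e01 L2.
pose K : R := L.+1%:R; have K0 : 0 < K by rewrite ltr0n.
(* Half of eps is shared by the at most L + 1 errors of an estimate, the other half is left for the
   drift. *)
pose e := eps / (2 * K); pose dl := delta / K.
have ep : 0 < e by rewrite divr_gt0 ?mulr_gt0.
have dlp : 0 < dl by rewrite divr_gt0.
pose c l : R := if (l < L)%N then (2 ^ l)%:R * alpha else 1.
have cp l : 0 < c l by rewrite /c; case: ifP => // _; rewrite mulr_gt0 // ltr0n expn_gt0.
pose ell := at_least1 (ln (1 / dl)).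
pose q l : R := c l / e * Num.sqrt ell + ell.
(* The seed type varies with the level; pairing it with its algorithm lets one choice function serve
   all levels. *)
have hs l : exists F : {T : finType & T -> comp R n R}, [/\ (0 < #|projT1 F|)%N,
    forall B w, (cost B (projT2 F w))%:R <= static_const * q l &
    forall B, factorized B (c l) ->
      Pr R (fun w => e < `|run B (projT2 F w) - \tr B|) <= dl].
  by have [T [al [h1 h2 h3]]] := static_estimator n (cp l) ep dlp; exists (existT _ T al).
have [F hF] := choice hs.
have F0 l : (0 < #|projT1 (F l)|)%N by have [] := hF l.
have [T [a [T0 aE aP]]] := @independent_copies R (comp R n R) (Ret 0)
  (fun l => projT1 (F l)) (fun l => projT2 (F l)) L.+1 F0.
have hw w := online_alg m (node_comp L l0 (a^~ w)) (@anchor_lt L l0).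
have [alg halg] := choice hw.
exists T, alg; split=> // A hA1 hA; split=> [w|i].
  have [_ hN] := halg w A.
  have q0 l : 0 <= static_const * q l.
    by have [_ h _] := hF l; have /card_gt0P[x _] := F0 l; apply: le_trans (h 0 x).
  apply: (@le_trans _ _ (\sum_(i < m) (cost (mx_diff A (anchor L l0) i)
      (node_comp L l0 (a^~ w) i)).*2)%:R); first by rewrite ler_nat.
  apply: le_trans (scheme_cost m l0 (L := L) (mx_diff A (anchor L l0)) q0 _) _.
    move=> l B lL; have [x ->] := aE l w lL; by have [_ h _] := hF l.
  have a01 : 0 < alpha < 1 by rewrite a0.
  have L12 : (2 ^ L)%:R <= 1 / alpha < (2 ^ L.+1)%:R by rewrite L1.
  have := scheme_cost_bound m a01 d0 e01 L12 hl0' (erefl ell) (fun l => erefl (q l)).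
  set X := 2 * _ => hX.
  have -> : 2 * ((1 + m%:R / (2 ^ L)%:R) * (static_const * q L) +
      \sum_(l0 <= l < L) m%:R / (2 ^ l)%:R * (static_const * q l)) = static_const * X.
    rewrite /X [RHS]mulrCA [in RHS]mulrDr; congr (2 * (_ + _)); first by rewrite mulrCA.
    rewrite [RHS]mulr_sumr.
    by apply: eq_bigr => l _; rewrite mulrCA.
  by rewrite [48 * static_const]mulrC -mulrA ler_wpM2l // ltW // static_const_gt0.
have hPr l (B : 'M[R]_n) : (l <= L)%N -> factorized B (c l) ->
    Pr R (fun w => e < `|run B (a l w) - \tr B|) <= dl.
  move=> lL hB; rewrite (aP l (fun x => e < `|run B x - \tr B|)) //.
  by have [_ _] := hF l; apply.
have aL D : factorized D 1 -> Pr R (fun w => e < `|run D (a L w) - \tr D|) <= dl.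
  by move=> hD; apply: hPr; rewrite // /c ltnn.
have al l D : (l < L)%N -> factorized D ((2 ^ l)%:R * alpha) ->
    Pr R (fun w => e < `|run D (a l w) - \tr D|) <= dl.
  by move=> lL hD; apply: hPr; rewrite ?(ltnW lL) // /c lL.
pose est i w := nth 0 (outputs A (alg w)) i.
have estE j w : (j < m)%N -> est j w = oapp (est^~ w) 0 (anchor L l0 j) +
    run (mx_diff A (anchor L l0) j) (node_comp L l0 (a^~ w) j).
  by move=> jm; have [h _] := halg w A; rewrite /est h.
have KL : (L - l0).+1%:R <= K by rewrite ler_nat ltnS leq_subr.
have herr := online_error l0L ep dlp hA1 hA aL al estE (ltn_ord i).
apply: (@le_trans _ _ ((L - l0).+1%:R * dl)); last first.
  by apply: le_trans (ler_wpM2r (ltW dlp) KL) _; rewrite /dl mulrC divfK // gt_eqF.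
apply: le_trans herr; apply: le_Pr => w; rewrite mx_atE; apply: le_lt_trans.
have hKe : (L - l0).+1%:R * e <= eps / 2.
  apply: le_trans (ler_wpM2r (ltW ep) KL) _.
  by rewrite (_ : K * e = eps / 2) // /e; field; rewrite gt_eqF.
by rewrite [leRHS](_ : eps = eps / 2 + eps / 2) ?lerD //; field.
Qed.

Theorem theorem3p1 (R : realType) :
  exists C : R, 0 < C /\
    forall (m n : nat) (alpha delta eps : R),
      (1 <= m)%N -> (1 <= n)%N -> 0 < alpha < 1 -> 0 < delta -> 0 < eps ->
      exists (d : measure_display) (Omega : measurableType d)
        (P : probability Omega R) (alg : Omega -> query_alg R m n 0),
        forall A : 'I_m -> 'M[R]_n,
          (forall i : 'I_m, nuclear_norm (A i) <= 1) ->
          (forall i j : 'I_m, j = i.+1 :> nat ->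
             nuclear_norm (A j - A i) <= alpha) ->
          (forall w : Omega,
             (num_queries A (alg w))%:R <= C * query_bound m alpha delta eps) /\
          (forall i : 'I_m,
             let success : set Omega :=
               [set w | `|estimate A (alg w) i - \tr (A i)| <= eps] in
             measurable success /\ ((1 - delta)%:E <= P success)%E).
Proof.
exists (48 * static_const).
split=> [|m n alpha delta eps _ _ ha hd he]; first by rewrite mulr_gt0 // static_const_gt0.
have [T [alg [T0 halg]]] := seeded_online_alg m n ha hd he.
have [d [S [P [f hf]]]] := finite_uniform_space R T0.
exists d, S, P, (alg \o f) => A hA1 hA; have [hN hE] := halg A hA1 hA.
split=> [w|i /=]; first exact: hN.
have [hm hP] := hf (fun x => `|estimate A (alg x) i - \tr (A i)| <= eps).
split; first exact: hm.
apply: le_trans (_ : (Pr R (fun x => `|estimate A (alg x) i - \tr (A i)| <= eps))%:E <= _)%E.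
  rewrite lee_fin lerBlDr -lerBlDl -Pr_predC //.
  by apply: le_trans (hE i); apply: le_Pr => x; rewrite -ltNge.
by rewrite -hP.
Qed.
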